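(* Let $T$ be a Sarason-Toeplitz operator on $H^2$. There exists a symbol $\phi\in N^+$ for which $T=M_\phi$ (as operators, including equality of domains) if and only if $\langle T(zf),1\rangle=0$ for all $f\in D(T)$. Moreover, in this case the Sarason Sub-Symbol of $T$ is unique, i.e. $R_{f_1}=R_{f_2}$ for all $f_1,f_2\in D(T)\setminus\{0\}$.
   Context: $H^2=H^2(\mathbb{T})$ is the Hardy space (subspace of $L^2(\mathbb{T})$ spanned by $\{e^{in\theta}\}_{n\ge0}$, equivalently analytic functions on the unit disc with square-summable Taylor coefficients); $S=M_z$ is the shift. A Sarason-Toeplitz operator is a closed, densely defined operator $T$ on $H^2$ with domain $D(T)$ such that: (1) $zf\in D(T)$ whenever $f\in D(T)$; (2) $S^*T(zf)=Tf$ for all $f\in D(T)$; (3) if $f\in D(T)$ and $f(0)=0$ then $S^*f\in D(T)$. $N^+$ denotes the Smirnov class (functions on the disc of the form $b/a$ with $a,b\in H^\infty$, $a$ outer). For an analytic function $\phi$, $M_\phi$ is the operator $f\mapsto\phi f$ on $D(M_\phi)=\{f\in H^2:\phi f\in H^2\}$. For $f\in D(T)\setminus\{0\}$, the Sarason Sub-Symbol is $R_f=h_f/f$ with $h_f=\sum_{n=1}^\infty \langle T(z^nf),1\rangle e^{-in\theta}+\sum_{n=0}^\infty\langle Tf,z^n\rangle e^{in\theta}$. *)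

(* Defs.v *)
From HB Require Import structures.
From mathcomp Require Import all_boot all_order all_algebra.
From mathcomp Require Import all_classical all_reals all_analysis.
From mathcomp Require Import complex.
Set Implicit Arguments. Unset Strict Implicit. Unset Printing Implicit Defensive.
Import Order.TTheory GRing.Theory Num.Theory.
Import numFieldNormedType.Exports.
Local Open Scope ring_scope.
Local Open Scope classical_set_scope.

Section HardyDefs.
Variable R : realType.
Local Notation C := (R[i]).

(* An analytic function on the unit disc, and an element of H^2, are
   represented by their sequence of Taylor coefficients (equivalently,
   for H^2, the Fourier coefficients of the boundary function). *)
Definition seqC := nat -> C.

Definition nrm2 (z : C) : R := (complex.Re z) ^+ 2 + (complex.Im z) ^+ 2.

Definition cvgC (u : nat -> C) : Prop :=
  cvgn (fun n => complex.Re (u n)) /\ cvgn (fun n => complex.Im (u n)).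
Definition limC (u : nat -> C) : C :=
  Complex (limn (fun n => complex.Re (u n))) (limn (fun n => complex.Im (u n))).

Definition H2 (f : seqC) : Prop := cvgn (series (fun n => nrm2 (f n))).
Definition H2norm (f : seqC) : R := Num.sqrt (limn (series (fun n => nrm2 (f n)))).
Definition H2dist (f g : seqC) : R := H2norm (fun n => f n - g n).

(* inner product <g, z^n> = n-th coefficient; in particular <g,1> = g 0 *)

Definition zshift (f : seqC) : seqC := fun n => if n is k.+1 then f k else 0.
Definition backshift (f : seqC) : seqC := fun n => f n.+1.

Definition psum (a : seqC) (z : C) : nat -> C :=
  fun N => \sum_(k < N) a k * z ^+ k.
Definition ps_conv (a : seqC) (z : C) : Prop := cvgC (psum a z).
Definition ps_eval (a : seqC) (z : C) : C := limC (psum a z).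

Definition in_disc (z : C) : Prop := nrm2 z < 1.

Definition analytic_disc (a : seqC) : Prop := forall z, in_disc z -> ps_conv a z.

Definition Hinf (a : seqC) : Prop :=
  analytic_disc a /\ exists M : R, forall z, in_disc z -> nrm2 (ps_eval a z) <= M.

(* Cauchy product = Taylor coefficients of the product of analytic functions *)
Definition cauchy (a f : seqC) : seqC :=
  fun k => \sum_(i < k.+1) a i * f (k - i)%N.

Definition polyseqC (p : seq C) : seqC := fun n => p`_n.

(* outer function (in H^2): a cyclic vector for the zshift, i.e. the
   polynomial multiples p*a are dense in H^2 *)
Definition outer (a : seqC) : Prop :=
  H2 a /\ forall f, H2 f -> forall eps : R, 0 < eps ->
    exists p : seq C, H2dist (cauchy (polyseqC p) a) f < eps.

Definition smirnov (phi : seqC) : Prop :=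
  analytic_disc phi /\
  exists a b : seqC, [/\ Hinf a, Hinf b, outer a &
    forall z, in_disc z -> ps_eval a z != 0 /\
                           ps_eval phi z = ps_eval b z / ps_eval a z].

Definition dom_M (phi : seqC) : set seqC := [set f | H2 f /\ H2 (cauchy phi f)].
Definition M_op (phi : seqC) (f : seqC) : seqC := cauchy phi f.

Definition closed_dd_operator (D : set seqC) (T : seqC -> seqC) : Prop :=
  [/\ (forall f, D f -> H2 f /\ H2 (T f)),
      D (fun _ => 0) /\
      (forall f g, D f -> D g -> D (fun n => f n + g n) /\
                                 T (fun n => f n + g n) = (fun n => T f n + T g n)) /\
      (forall (c : C) f, D f -> D (fun n => c * f n) /\
                               T (fun n => c * f n) = (fun n => c * T f n)),
      (forall f, H2 f -> forall eps : R, 0 < eps -> exists2 g, D g & H2dist f g < eps) &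
      (forall (u : nat -> seqC) (f g : seqC), (forall k, D (u k)) -> H2 f -> H2 g ->
         (fun k => H2dist (u k) f) @ \oo --> (0 : R) ->
         (fun k => H2dist (T (u k)) g) @ \oo --> (0 : R) ->
         D f /\ T f = g)].

Definition sarason_toeplitz (D : set seqC) (T : seqC -> seqC) : Prop :=
  [/\ closed_dd_operator D T,
      (forall f, D f -> D (zshift f)),
      (forall f, D f -> backshift (T (zshift f)) = T f) &
      (forall f, D f -> f 0%N = 0 -> D (backshift f))].

(* the function h_f, as its doubly-indexed Fourier coefficients:
   coefficient of e^{-i(n+1)theta} is <T(z^{n+1} f), 1>,
   coefficient of e^{i n theta} is <T f, z^n> *)
Definition hf (T : seqC -> seqC) (f : seqC) : int -> C :=
  fun k => match k with
           | Posz n => T f n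
           | Negz n => T (iter n.+1 zshift f) 0%N
           end.

(* Fourier coefficients of the product h * g of a two-sided series h with
   an H^2 function g: (h g)_k = sum_{j >= 0} h(k - j) g(j) *)
Definition fprod (h : int -> C) (g : seqC) : int -> C :=
  fun k => limC (series (fun j => h (k - j%:Z)%R * g j)).

(* equality of Sarason sub-symbols R_{f1} = h_{f1}/f1 and R_{f2} = h_{f2}/f2,
   expressed by cross-multiplication h_{f1} f2 = h_{f2} f1 *)
Definition subsymbol_eq (T : seqC -> seqC) (f1 f2 : seqC) : Prop :=
  forall k : int, fprod (hf T f1) f2 k = fprod (hf T f2) f1 k.

End HardyDefs.

(* Main.v *)
Require Import Defs.
From HB Require Import structures.
From mathcomp Require Import all_boot all_order all_algebra.
From mathcomp Require Import all_classical all_reals all_analysis.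
From mathcomp Require Import complex.
From mathcomp Require Import ring lra zify.
Set Implicit Arguments. Unset Strict Implicit. Unset Printing Implicit Defensive.
Import Order.TTheory GRing.Theory Num.Theory.
(* [Defs] is imported again because [cauchy] is also a filter notion of the
   topology library; here it must denote the Cauchy product. *)
Import numFieldNormedType.Exports Defs.
Local Open Scope ring_scope.
Local Open Scope classical_set_scope.

(** If [T] commutes with the shift, its graph [G] is a closed shift-invariant
    subspace of [H^2 x H^2], and condition (3) says that the pairs of [G] whose first
    entry vanishes at [0] are exactly [z G].  Let [x = (a, b)] be the element of
    minimal norm among the pairs with first entry [1] at [0].  It is orthogonal to
    [z G], so [h |-> h x] multiplies norms by a constant and maps [H^2] onto [G]
    (a Beurling theorem).  Hence [a] and [b] are bounded, [a] is outer because the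
    domain is dense, and [T = M_phi] on the domain for [phi = b / a].  The power
    series of [1 / a] converges in the whole disc: some polynomial [p] makes
    [p a - 1] small in [H^2], hence in [l^1] with weight [r^n], where [p a] is then
    invertible.

    For the equality of domains, the graph [G'] of [M_phi] is a subspace of the same
    kind containing [G], with minimal element [x'] and [x = theta x'].  Since
    polynomials [p] exist with [p a] near [1], comparing the norms of
    [(p a') x = (p a) x'] gives [|x| <= |x'|], so [x = x'] and [G = G']. *)

(** * Formal power series under the Cauchy product *)

Section FormalSeries.
Variable R : realType.
Local Notation C := (R[i]).
Implicit Types (a b c f g h : seqC R) (n k : nat).

Definition seq1 : seqC R := fun n => (n == 0%N)%:R.
(** A single operation for both vector space laws; the difference [g - f] is written
    [comb (-1) f g]. *)
Definition comb (c : C) (f g : seqC R) : seqC R := fun n => c * f n + g n.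
Definition trunc n (h : seqC R) : seqC R := fun k => if (k < n)%N then h k else 0.

(** Coefficients below [n] only see truncations, so the ring laws of the Cauchy product are
    inherited from polynomials. *)
Lemma cauchy_coefM a b n k : (k < n)%N ->
  cauchy a b k = (\poly_(i < n) a i * \poly_(i < n) b i)`_k.
Proof.
move=> kn; rewrite coefM /cauchy; apply: eq_bigr => i _; rewrite !coef_poly.
have -> : (i < n)%N by have := ltn_ord i; lia.
by have -> : (k - i < n)%N by lia.
Qed.

Lemma cauchyC a b : cauchy a b = cauchy b a.
Proof. by apply/funext => k; rewrite !(cauchy_coefM _ _ (ltnSn k)) mulrC. Qed.

Lemma cauchyA a b c : cauchy a (cauchy b c) = cauchy (cauchy a b) c.
Proof.
apply/funext => k; transitivity
  ((\poly_(i < k.+1) a i * (\poly_(i < k.+1) b i * \poly_(i < k.+1) c i))`_k).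
  rewrite coefM; apply: eq_bigr => i _; rewrite -cauchy_coefM; last by lia.
  by rewrite coef_poly ltn_ord.
rewrite mulrA coefM; apply: eq_bigr => i _; rewrite -cauchy_coefM ?ltn_ord//.
by rewrite coef_poly; have -> : (k - i < k.+1)%N by lia.
Qed.

(** Horner step [h = h(0) + z h'], with [h'] the backward shift of [h]; it drives the inductions on
    truncations. *)
Lemma cauchyS h f : cauchy h f = comb (h 0%N) f (zshift (cauchy (backshift h) f)).
Proof.
apply/funext => -[|k]; rewrite /cauchy /comb /=.
  by rewrite big_ord_recl big_ord0.
by rewrite big_ord_recl /=; congr (_ + _); apply: eq_bigr.
Qed.

Lemma cauchy_comb_r a (c : C) f g :
  cauchy a (comb c f g) = comb c (cauchy a f) (cauchy a g).
Proof.
apply/funext => k; rewrite /cauchy /comb mulr_sumr -big_split /=.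
by apply: eq_bigr => i _; rewrite mulrDr mulrCA.
Qed.

Lemma cauchy_comb_l a (c : C) f g :
  cauchy (comb c f g) a = comb c (cauchy f a) (cauchy g a).
Proof. by rewrite !(cauchyC _ a) cauchy_comb_r. Qed.

Lemma cauchy0 a : cauchy (fun=> 0) a = fun=> 0.
Proof. by apply/funext => k; rewrite /cauchy big1// => i _; rewrite mul0r. Qed.

Lemma zshift0 : zshift (fun=> 0 : C) = fun=> 0.
Proof. by apply/funext => -[]. Qed.

Lemma cauchy1 f : cauchy seq1 f = f.
Proof.
rewrite cauchyS (_ : backshift seq1 = fun=> 0)// cauchy0 zshift0.
by apply/funext => k; rewrite /comb /seq1 eqxx mul1r addr0.
Qed.

Lemma cauchy_zshift a f : cauchy a (zshift f) = zshift (cauchy a f).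
Proof.
rewrite !(cauchyC a) cauchyS /=; apply/funext => -[|k]; rewrite /comb/= mul0r add0r//.
Qed.

Lemma zshift_backshift f : f 0%N = 0 -> zshift (backshift f) = f.
Proof. by move=> f0; apply/funext => -[|k] //=; rewrite f0. Qed.

Lemma cauchy_coef0 a f : cauchy a f 0%N = a 0%N * f 0%N.
Proof. by rewrite /cauchy big_ord_recl big_ord0 addr0. Qed.

Lemma backshift_truncS n h : backshift (trunc n.+1 h) = trunc n (backshift h).
Proof. by []. Qed.

Lemma cauchy_trunc n h f k : (k < n)%N -> cauchy (trunc n h) f k = cauchy h f k.
Proof.
by move=> kn; apply: eq_bigr => i _; rewrite /trunc; have -> : (i < n)%N by have := ltn_ord i; lia.
Qed.

Lemma polyseqC_mkseq n h : polyseqC (mkseq h n) = trunc n h.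
Proof.
apply/funext => k; rewrite /polyseqC /trunc; case: ltnP => kn.
  by rewrite nth_mkseq.
by rewrite nth_default// size_mkseq.
Qed.

Lemma polyseqC_trunc (p : seq C) : polyseqC p = trunc (size p) (polyseqC p).
Proof.
by apply/funext => k; rewrite /polyseqC /trunc; case: ltnP => // /(nth_default 0).
Qed.

(* [recip_prefix a n] lists the first [n] coefficients of [1/a] when [a 0 = 1]. *)
Fixpoint recip_prefix a n : seq C :=
  if n is m.+1 then let s := recip_prefix a m in
    rcons s ((m == 0%N)%:R - \sum_(i < m) a i.+1 * s`_(m - i.+1))
  else [::].

Lemma size_recip_prefix a n : size (recip_prefix a n) = n.
Proof. by elim: n => //= n IH; rewrite size_rcons IH. Qed.

Definition recip a : seqC R := fun k => (recip_prefix a k.+1)`_k.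

Lemma nth_recip_prefix a n k : (k < n)%N -> (recip_prefix a n)`_k = recip a k.
Proof.
elim: n => // n IH; rewrite ltnS leq_eqVlt => /orP[/eqP->//|kn] /=.
by rewrite nth_rcons size_recip_prefix kn IH.
Qed.

Lemma cauchy_recip a : a 0%N = 1 -> cauchy a (recip a) = seq1.
Proof.
move=> a0; apply/funext => k; rewrite /cauchy big_ord_recl a0 mul1r subn0.
rewrite {1}/recip /= nth_rcons size_recip_prefix ltnn eqxx.
rewrite (_ : \sum_(i < k) _ = \sum_(i < k) a i.+1 * recip a (k - i.+1)%N) ?subrK//.
by apply: eq_bigr => i _; rewrite nth_recip_prefix//; have := ltn_ord i; lia.
Qed.

End FormalSeries.
Arguments seq1 {R}.

(** * The Hilbert space [H^2 x H^2] through squared norms *)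

Section PairSpace.
Variable R : realType.
Local Notation C := (R[i]).
Local Notation P := (seqC R * seqC R)%type.
Implicit Types (f g h : seqC R) (x y w : P) (n k : nat) (c : C).

Lemma nnseries_cvg (u : nat -> R) B : (forall n, 0 <= u n) ->
  (forall N, series u N <= B) -> cvgn (series u).
Proof.
move=> u0 uB; apply: nondecreasing_is_cvgn; first exact: nondecreasing_series.
by exists B => _ [n _ <-]; exact: uB.
Qed.

Lemma nnseries_lim_le (u : nat -> R) B : (forall n, 0 <= u n) ->
  (forall N, series u N <= B) -> limn (series u) <= B.
Proof.
by move=> u0 uB; apply: limr_le; [exact: (nnseries_cvg u0 uB)|exact: nearW].
Qed.

Lemma H2_bounded f B : (forall N, series (fun n => nrm2 (f n)) N <= B) -> H2 f.
Proof. by apply: nnseries_cvg => n; rewrite /nrm2 addr_ge0 ?sqr_ge0. Qed.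

Lemma nnseries_le_lim (u : nat -> R) N : (forall n, 0 <= u n) ->
  cvgn (series u) -> series u N <= limn (series u).
Proof.
by move=> u0 cu; apply: nondecreasing_cvgn_le => //; exact: nondecreasing_series.
Qed.

Lemma le_series (u v : nat -> R) N : (forall n, (n < N)%N -> u n <= v n) ->
  series u N <= series v N.
Proof. by move=> uv; rewrite !seriesEord/=; apply: ler_sum => i _; exact: uv. Qed.

Lemma nrm2_ge0 c : 0 <= nrm2 c.
Proof. by rewrite /nrm2 addr_ge0 ?sqr_ge0. Qed.

Lemma nrm20 : nrm2 (0 : C) = 0.
Proof. by rewrite /nrm2 /= expr0n /= addr0. Qed.

Lemma nrm2_eq0 c : nrm2 c = 0 -> c = 0.
Proof.
case: c => a b; rewrite /nrm2 /= => /eqP; rewrite paddr_eq0 ?sqr_ge0// !sqrf_eq0.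
by move=> /andP[/eqP-> /eqP->].
Qed.

Lemma nrm2M c (d : C) : nrm2 (c * d) = nrm2 c * nrm2 d.
Proof. by case: c d => a b [d e]; rewrite /nrm2 /=; ring. Qed.

Definition qn x n : R := nrm2 (x.1 n) + nrm2 (x.2 n).
Definition HP x : Prop := cvgn (series (qn x)).
(** The squared norm of [H^2 x H^2], kept without a root so that norm identities are polynomial in
    the coefficients and can be proved termwise. *)
Definition NP x : R := limn (series (qn x)).
Definition N2 f : R := limn (series (fun n => nrm2 (f n))).
Definition pcomb c x y : P := (comb c x.1 y.1, comb c x.2 y.2).
Definition pshift x : P := (zshift x.1, zshift x.2).
Definition pback x : P := (backshift x.1, backshift x.2).
Definition pmul h x : P := (cauchy h x.1, cauchy h x.2).
Definition p0 : P := (fun=> 0, fun=> 0).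

Lemma qn_ge0 x n : 0 <= qn x n.
Proof. by rewrite addr_ge0 ?nrm2_ge0. Qed.

Lemma HP_bounded x B : (forall N, series (qn x) N <= B) -> HP x.
Proof. exact/nnseries_cvg/qn_ge0. Qed.

Lemma NP_le x B : (forall N, series (qn x) N <= B) -> NP x <= B.
Proof. exact/nnseries_lim_le/qn_ge0. Qed.

Lemma qseries_le_NP x N : HP x -> series (qn x) N <= NP x.
Proof. exact/nnseries_le_lim/qn_ge0. Qed.

Lemma NP_ge0 x : HP x -> 0 <= NP x.
Proof. by move=> /(qseries_le_NP 0); rewrite seriesEord/= big_ord0. Qed.

Lemma qn_le_NP x n : HP x -> qn x n <= NP x.
Proof.
move=> /(qseries_le_NP n.+1); apply: le_trans; rewrite seriesSr lerDr.
by rewrite seriesEord/= sumr_ge0// => i _; exact: qn_ge0.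
Qed.

Lemma NP_cvg x : HP x -> series (qn x) @ \oo --> NP x.
Proof. by []. Qed.

Lemma qseriesE x N : series (qn x) N =
  series (fun n => nrm2 (x.1 n)) N + series (fun n => nrm2 (x.2 n)) N.
Proof. by rewrite !seriesEord/= -big_split. Qed.

Lemma HP_N2 x : H2 x.1 -> H2 x.2 -> HP x /\ NP x = N2 x.1 + N2 x.2.
Proof.
move=> h1 h2; have cx : series (qn x) @ \oo --> N2 x.1 + N2 x.2.
  rewrite (_ : series (qn x) = (fun N => series (fun n => nrm2 (x.1 n)) N +
    series (fun n => nrm2 (x.2 n)) N)); last by apply/funext => N; rewrite qseriesE.
  exact: cvgD.
by split; [apply/cvg_ex; eexists; exact: cx | exact: cvg_lim cx].
Qed.

Lemma HP_H2 x : HP x -> H2 x.1 /\ H2 x.2.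
Proof.
move=> hx; split; apply: (@H2_bounded _ (NP x)) => N;
  apply: le_trans (qseries_le_NP N hx);
  by apply: le_series => n _; rewrite ?lerDl ?lerDr nrm2_ge0.
Qed.

Lemma N2_ge0 f : H2 f -> 0 <= N2 f.
Proof.
move=> hf; apply: le_trans (nnseries_le_lim 0 (fun=> nrm2_ge0 _) hf).
by rewrite seriesEord/= big_ord0.
Qed.

Lemma nrm2_le_N2 f n : H2 f -> nrm2 (f n) <= N2 f.
Proof.
move=> hf; apply: le_trans (nnseries_le_lim n.+1 (fun=> nrm2_ge0 _) hf).
rewrite seriesSr lerDr seriesEord/= sumr_ge0// => i _; exact: nrm2_ge0.
Qed.

(** The difference of the two sides is [|c a - b|^2]. *)
Lemma nrm2_comb_le c (a b : C) : nrm2 (c * a + b) <= 2 * nrm2 c * nrm2 a + 2 * nrm2 b.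
Proof.
case: c a b => [c1 c2] [a1 a2] [b1 b2]; rewrite /nrm2 /= -subr_ge0.
rewrite (_ : _ - _ = (c1 * a1 - c2 * a2 - b1) ^+ 2 + (c1 * a2 + c2 * a1 - b2) ^+ 2).
  by rewrite addr_ge0 ?sqr_ge0.
by ring.
Qed.

Lemma HP_comb c x y : HP x -> HP y -> HP (pcomb c x y).
Proof.
move=> hx hy; apply: (@HP_bounded _ (2 * nrm2 c * NP x + 2 * NP y)) => N.
apply: (@le_trans _ _ (2 * nrm2 c * series (qn x) N + 2 * series (qn y) N)).
  rewrite !seriesEord/= !mulr_sumr -big_split; apply: ler_sum => i _ /=.
  apply: le_trans (lerD (nrm2_comb_le _ _ _) (nrm2_comb_le _ _ _)) _.
  by rewrite /qn; lra.
by apply: lerD; apply: ler_wpM2l; rewrite ?mulr_ge0 ?nrm2_ge0 ?qseries_le_NP.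
Qed.

Lemma H2_zero : H2 (fun=> 0 : C).
Proof.
by apply: (@H2_bounded _ 0) => N; rewrite seriesEord/= big1// => i _; rewrite nrm20.
Qed.

Lemma H2_comb c f g : H2 f -> H2 g -> H2 (comb c f g).
Proof.
move=> hf hg; have [] // := HP_H2 (HP_comb (c := c)
  (HP_N2 (x := (f, fun=> 0)) hf H2_zero).1 (HP_N2 (x := (g, fun=> 0)) hg H2_zero).1).
Qed.

Lemma HP0 : HP p0 /\ NP p0 = 0.
Proof.
have b N : series (qn p0) N <= 0.
  by rewrite seriesEord/= big1// => i _; rewrite /qn/= nrm20 addr0.
have h1 := HP_bounded b; split=> //; apply/eqP.
by rewrite eq_le NP_le// NP_ge0.
Qed.

Lemma NP_eq0 x : HP x -> NP x <= 0 -> x = p0.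
Proof.
move=> hx x0; have q0 n : qn x n = 0.
  by apply/eqP; rewrite eq_le qn_ge0 andbT (le_trans (qn_le_NP _ hx)).
case: x hx x0 q0 => f g _ _ q0; congr (_, _); apply/funext => n; apply: nrm2_eq0;
  move: (q0 n) => /eqP; rewrite paddr_eq0 ?nrm2_ge0//= => /andP[/eqP + /eqP +];
  by [].
Qed.

Lemma NP_scale c x : HP x -> NP (pcomb c x p0) = nrm2 c * NP x.
Proof.
move=> hx; apply: cvg_lim => //.
rewrite (_ : series _ = (fun N => nrm2 c * series (qn x) N)).
  exact: cvgMr (NP_cvg hx).
apply/funext => N; rewrite !seriesEord/= mulr_sumr; apply: eq_bigr => i _.
by rewrite /qn/= /comb/= !addr0 !nrm2M -mulrDr.
Qed.

(* Polynomial in [t]: this replaces the inner product in every orthogonality argument. *)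
Lemma NP_line x y (t : R) : HP x -> HP y ->
  NP (pcomb t%:C%C y x) = (1 - t) * NP x + t * NP (pcomb 1 y x) + (t ^+ 2 - t) * NP y.
Proof.
move=> hx hy; apply: cvg_lim => //.
rewrite (_ : series _ = (fun N => (1 - t) * series (qn x) N +
  t * series (qn (pcomb 1 y x)) N + (t ^+ 2 - t) * series (qn y) N)).
  by apply: cvgD; [apply: cvgD|]; apply: cvgMr; apply: NP_cvg => //; exact: HP_comb.
apply/funext => N; rewrite !seriesEord/= !mulr_sumr -!big_split.
apply: eq_bigr => i _ /=; rewrite /qn/= /comb/=.
case: x hx y hy => [f g] _ [f' g'] _ /=.
case: (f i) (g i) (f' i) (g' i) => [? ?] [? ?] [? ?] [? ?].
by rewrite /nrm2 /=; ring.
Qed.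

Definition pmid x y : P := pcomb (2^-1)%:C%C x (pcomb (2^-1)%:C%C y p0).

Lemma parallelogram x y : HP x -> HP y ->
  NP (pcomb (-1) x y) = 2 * NP x + 2 * NP y - 4 * NP (pmid x y).
Proof.
move=> hx hy; apply: cvg_lim => //.
rewrite (_ : series _ = (fun N => 2 * series (qn x) N +
  2 * series (qn y) N - 4 * series (qn (pmid x y)) N)).
  apply: cvgB; first by apply: cvgD; apply: cvgMr; apply: NP_cvg.
  apply: cvgMr; apply: NP_cvg; apply: HP_comb => //; apply: HP_comb => //.
  exact: HP0.1.
apply/funext => N; rewrite !seriesEord/= !mulr_sumr -sumrN -!big_split.
apply: eq_bigr => i _ /=; rewrite /qn/= /comb/=.
case: x hx y hy => [f g] _ [f' g'] _ /=.
case: (f i) (g i) (f' i) (g' i) => [? ?] [? ?] [? ?] [? ?].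
by rewrite /nrm2 /=; field.
Qed.

Lemma NP_shift x : HP x -> HP (pshift x) /\ NP (pshift x) = NP x.
Proof.
move=> hx; have c : series (qn (pshift x)) @ \oo --> NP x.
  rewrite -cvg_shiftS (_ : (fun n => _) = series (qn x)); first exact: NP_cvg.
  apply/funext => N; rewrite seriesEord/= big_ord_recl/= seriesEord/=.
  by rewrite {1}/qn/= nrm20 addr0 add0r.
by split; [apply/cvg_ex; eexists; exact: c | exact: cvg_lim c].
Qed.

(** Membership in the closure of [G], measured by the squared norm. *)
Definition pdense_at (G : P -> Prop) x : Prop :=
  forall e : R, 0 < e -> exists2 y, G y & HP (pcomb (-1) x y) /\ NP (pcomb (-1) x y) < e.

(** The common features of the graphs of [T] and of [M_phi]. The field [sg_back] combines condition
    (3) with commutation with the shift: a pair whose first entry vanishes at [0] is [z] times a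
    pair of [G]. *)
Record shift_graph (G : P -> Prop) : Prop := ShiftGraph {
  sg_HP : forall x, G x -> HP x;
  sg_0 : G p0;
  sg_comb : forall c x y, G x -> G y -> G (pcomb c x y);
  sg_closed : forall x, HP x -> pdense_at G x -> G x;
  sg_shift : forall x, G x -> G (pshift x);
  sg_back : forall x, G x -> x.1 0%N = 0 -> x.2 0%N = 0 /\ G (pback x);
  sg_ntriv : exists2 x, G x & x.1 0%N != 0 }.

End PairSpace.
Arguments p0 {R}.

(** * Complex limits and coefficientwise limits of pairs *)

Section ComplexLimits.
Variable R : realType.
Local Notation C := (R[i]).
Local Notation P := (seqC R * seqC R)%type.
Implicit Types (u v : nat -> C) (X : nat -> P) (x y : P).

Definition cvC u (l : C) : Prop :=
  (fun n => complex.Re (u n)) @ \oo --> complex.Re l /\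
  (fun n => complex.Im (u n)) @ \oo --> complex.Im l.

Lemma cvC_limC u l : cvC u l -> limC u = l.
Proof.
case: l => a b [ca cb]; rewrite /limC; congr Complex; exact: cvg_lim.
Qed.

Lemma cvC_cvgC u l : cvC u l -> cvgC u.
Proof. by move=> [ca cb]; split; apply/cvg_ex; eexists; [exact: ca|exact: cb]. Qed.

Lemma cvgC_cvC u : cvgC u -> cvC u (limC u).
Proof. by []. Qed.

Lemma cvC_cst (l : C) : cvC (fun=> l) l.
Proof. by split; exact: cvg_cst. Qed.

Lemma cvCD u v l m : cvC u l -> cvC v m -> cvC (fun n => u n + v n) (l + m).
Proof.
case: l m => a b [a' b'] [ca cb] [ca' cb']; split => /=.
  rewrite (_ : (fun n => _) = fun n => complex.Re (u n) + complex.Re (v n)).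
    exact: cvgD.
  by apply/funext => n; case: (u n) (v n) => ? ? [].
rewrite (_ : (fun n => _) = fun n => complex.Im (u n) + complex.Im (v n)).
  exact: cvgD.
by apply/funext => n; case: (u n) (v n) => ? ? [].
Qed.

Lemma cvCM u v l m : cvC u l -> cvC v m -> cvC (fun n => u n * v n) (l * m).
Proof.
case: l m => a b [a' b'] [ca cb] [ca' cb']; split => /=.
  rewrite (_ : (fun n => _) = fun n => complex.Re (u n) * complex.Re (v n) -
    complex.Im (u n) * complex.Im (v n)).
    by apply: cvgB; exact: cvgM.
  by apply/funext => n; case: (u n) (v n) => ? ? [].
rewrite (_ : (fun n => _) = fun n => complex.Re (u n) * complex.Im (v n) +
  complex.Im (u n) * complex.Re (v n)).
  by apply: cvgD; exact: cvgM.
by apply/funext => n; case: (u n) (v n) => ? ? [].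
Qed.

Lemma cvC_unique u l m : cvC u l -> cvC u m -> l = m.
Proof. by move=> /cvC_limC <- /cvC_limC <-. Qed.

Lemma nrm2_cvg u l : cvC u l -> (fun n => nrm2 (u n)) @ \oo --> nrm2 l.
Proof. by move=> [ca cb]; apply: cvgD; rewrite expr2; exact: cvgM. Qed.

Definition pcv X x : Prop := forall n,
  cvC (fun k => (X k).1 n) (x.1 n) /\ cvC (fun k => (X k).2 n) (x.2 n).

Lemma pcv_comb X x y c : pcv X x -> pcv (fun k => pcomb c (X k) y) (pcomb c x y).
Proof.
move=> cX n; have [c1 c2] := cX n.
by split; apply: cvCD (cvC_cst _); apply: cvCM (cvC_cst _) _.
Qed.

Lemma qseries_cvg X x N : pcv X x -> (fun k => series (qn (X k)) N) @ \oo --> series (qn x) N.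
Proof.
move=> cX; elim: N => [|N IH].
  rewrite seriesEord/= big_ord0 (_ : (fun k => _) = fun=> 0); first exact: cvg_cst.
  by apply/funext => k; rewrite seriesEord/= big_ord0.
rewrite seriesSr (_ : (fun k => _) = fun k => series (qn (X k)) N + qn (X k) N).
  by have [c1 c2] := cX N; apply: cvgD => //; apply: cvgD; exact: nrm2_cvg.
by apply/funext => k; rewrite seriesSr.
Qed.

(** A form of Fatou's lemma: a finite partial sum is continuous in finitely many coefficients, so
    coefficientwise convergence preserves norm bounds. *)
Lemma qseries_fatou X x (B : nat -> R) b N : pcv X x ->
  (forall k, series (qn (X k)) N <= B k) -> B @ \oo --> b -> series (qn x) N <= b.
Proof.
by move=> /(qseries_cvg (N := N)) cX XB cB; apply: ler_cvg_to cX cB _; exact: nearW.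
Qed.

(** The bound [e k + e l] is the shape that the parallelogram law gives along a minimizing
    sequence. *)
Lemma cauchy_rate_cvg (u e : nat -> R) : (forall k l, (u k - u l) ^+ 2 <= e k + e l) ->
  e @ \oo --> (0 : R) -> cvgn u.
Proof.
move=> ue e0; apply/cauchy_cvgP/cauchy_exP => eps eps0.
have d0 : 0 < eps ^+ 2 / 2 by rewrite divr_gt0 ?exprn_gt0.
move/cvgr0Pnorm_lt: e0 => /(_ _ d0) [K _ eK].
exists (u K), K => // k /= Kk; rewrite /ball/=.
have := ue K k; have := eK K (leqnn K); have := eK k Kk => /=.
move=> /(le_lt_trans (ler_norm _)) h1 /(le_lt_trans (ler_norm _)) h2 h3.
rewrite -(@ltr_pXn2r _ 2)// ?nnegrE ?(ltW eps0)// real_normK ?num_real//.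
by apply: le_lt_trans h3 _; lra.
Qed.

Lemma cvC_cauchy_rate (u : nat -> C) (e : nat -> R) :
  (forall k l, nrm2 (- 1 * u k + u l) <= e k + e l) ->
  e @ \oo --> (0 : R) -> cvC u (limC u).
Proof.
move=> ue e0; apply: cvgC_cvC; split; apply: cauchy_rate_cvg e0 => k l;
  apply: le_trans (ue k l); case: (u k) (u l) => a b [a' b'];
  rewrite /nrm2 /= -subr_ge0.
- rewrite (_ : _ - _ = (b - b') ^+ 2) ?sqr_ge0//; ring.
- rewrite (_ : _ - _ = (a - a') ^+ 2) ?sqr_ge0//; ring.
Qed.

End ComplexLimits.

(** * The minimal element and the Beurling-type factorization *)

Section Wandering.
Variable R : realType.
Local Notation C := (R[i]).
Local Notation P := (seqC R * seqC R)%type.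
Implicit Types (f g h : seqC R) (x y w : P) (n k : nat) (c : C).
Variable G : P -> Prop.
Hypothesis hG : shift_graph G.

(** Projection argument on the convex set of normalized pairs: a minimizing sequence is Cauchy by
    the parallelogram law, its limit is formed coefficient by coefficient, and closedness of [G]
    puts the limit in [G]. *)
Lemma exists_minimal : exists x, [/\ G x, x.1 0%N = 1 &
  forall y, G y -> y.1 0%N = 1 -> NP x <= NP y].
Proof.
pose A := [set NP y | y in [set y | G y /\ y.1 0%N = 1]].
have Alb : lbound A 0 by move=> _ [y [Gy _] <-]; exact/NP_ge0/(sg_HP hG).
have Ainf : has_inf A.
  split; last by exists 0.
  have [x Gx x0] := sg_ntriv hG.
  exists (NP (pcomb (x.1 0%N)^-1 x p0)), (pcomb (x.1 0%N)^-1 x p0) => //; split.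
    by apply: (sg_comb hG) => //; exact: sg_0 hG.
  by rewrite /= /comb/= addr0 mulVf.
have leA y : G y -> y.1 0%N = 1 -> inf A <= NP y.
  by move=> Gy y0; apply: ge_inf; [exists 0|exists y].
have /choice[X hX] : forall k, exists y, [/\ G y, y.1 0%N = 1 &
    NP y <= inf A + @harmonic R k].
  move=> k; have [_ [y [Gy y0] <-] ylt] := inf_adherent (harmonic_gt0 k) Ainf.
  by exists y; split=> //; exact: ltW.
pose e k := 2 * @harmonic R k.
have e0 : e @ \oo --> (0 : R) by rewrite -(mulr0 2); apply: cvgMr; exact: cvg_harmonic.
have HX k : HP (X k) by have [GX _ _] := hX k; exact: sg_HP hG _ GX.
have HXX k l : HP (pcomb (-1) (X k) (X l)) by exact: HP_comb.
(* The midpoint is again normalized, so its squared norm is at least [inf A]; only the two excesses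
   over the infimum remain, each doubled. *)
have XX k l : NP (pcomb (-1) (X k) (X l)) <= e k + e l.
  have [Gk k0 kle] := hX k; have [Gl l0 lle] := hX l.
  have /(leA _) : G (pmid (X k) (X l)).
    by apply: (sg_comb hG) => //; apply: (sg_comb hG) => //; exact: sg_0 hG.
  have -> : (pmid (X k) (X l)).1 0%N = 1.
    rewrite /pmid /= /comb /= k0 l0 addr0 !mulr1.
    by apply/eqP; rewrite eq_complex /=; apply/andP; split; apply/eqP; field.
  by rewrite parallelogram// /e => /(_ erefl); lra.
pose x : P := (fun n => limC (fun k => (X k).1 n), fun n => limC (fun k => (X k).2 n)).
have Xx : pcv X x.
  move=> n; split; apply: cvC_cauchy_rate e0 => k l; apply: le_trans (XX k l);
    apply: le_trans (qn_le_NP n (HXX k l)); by rewrite ?lerDl ?lerDr nrm2_ge0.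
(* Letting [k] tend to infinity in [XX] bounds the squared distance from [X l] to the
   coefficientwise limit. *)
have xl N l : series (qn (pcomb (-1) x (X l))) N <= e l.
  apply: (@qseries_fatou _ _ _ (fun k => e k + e l) _ _ (pcv_comb (X l) (-1) Xx)).
    by move=> k; apply: le_trans (XX k l); exact: qseries_le_NP.
  by rewrite -[X in _ --> X]add0r; apply: cvgD => //; exact: cvg_cst.
have xinf N : series (qn x) N <= inf A.
  apply: (@qseries_fatou _ _ _ (fun k => inf A + harmonic k) _ _ Xx).
    move=> k; have [_ _] := hX k; apply: le_trans; exact: qseries_le_NP.
  by rewrite -[X in _ --> X]addr0; apply: cvgD (cvg_harmonic); exact: cvg_cst.
have Hx := HP_bounded xinf.
exists x; split.
- apply: (sg_closed hG) => // d d0.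
  move/cvgr0Pnorm_lt: e0 => /(_ _ d0) [K _ /(_ _ (leqnn K)) /= eK].
  exists (X K); first by have [] := hX K.
  split; first exact: HP_bounded (xl^~ K).
  by apply: le_lt_trans (NP_le (xl^~ K)) (le_lt_trans (ler_norm _) eK).
- apply: cvC_limC; rewrite (_ : (fun k => _) = fun=> 1); first exact: cvC_cst.
  by apply/funext => k; have [] := hX k.
- by move=> y Gy y0; apply: le_trans (leA _ Gy y0); exact: NP_le.
Qed.

Variable x : P.
Hypotheses (Gx : G x) (x0 : x.1 0%N = 1)
  (xmin : forall y, G y -> y.1 0%N = 1 -> NP x <= NP y).

Let Hx : HP x. Proof. exact: sg_HP hG _ Gx. Qed.

Lemma NP_min_gt0 : 0 < NP x.
Proof.
apply: lt_le_trans (qn_le_NP 0 Hx); rewrite /qn x0.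
by apply: ltr_wpDr; rewrite ?nrm2_ge0// /nrm2 /= expr1n expr0n addr0.
Qed.

(* A real quadratic [t B + t^2 N >= 0] forces [B = 0]. *)
Lemma min_orthogonal y : G y -> y.1 0%N = 0 -> NP (pcomb 1 y x) = NP x + NP y.
Proof.
move=> Gy y0; have Hy := sg_HP hG Gy.
have line t : 0 <= t * (NP (pcomb 1 y x) - NP x - NP y) + t ^+ 2 * NP y.
  have : NP x <= NP (pcomb t%:C%C y x).
    by apply: xmin; [exact: sg_comb hG _ _ _ Gy Gx|rewrite /= /comb y0 x0 mulr0 add0r].
  by rewrite NP_line//; lra.
set B := NP (pcomb 1 y x) - NP x - NP y in line *.
suff : B = 0 by rewrite /B; lra.
(* Adding [1] keeps [M] positive even if [NP y = 0]; at [t = - B / M] the quadratic equals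
   [- B^2 / M^2]. *)
have Ny := NP_ge0 Hy; set M := NP y + 1.
have M0 : 0 < M by rewrite ltr_wpDl.
have := line (- B / M).
rewrite (_ : _ + _ = - (B ^+ 2 / M ^+ 2)); last by rewrite /M; field; rewrite lt0r_neq0.
rewrite oppr_ge0 => B0; apply/eqP; rewrite -sqrf_eq0.
have M2 : 0 < M ^+ 2 by rewrite exprn_gt0.
by move: B0; rewrite ler_pdivrMr// mul0r => B0; rewrite eq_le B0 sqr_ge0.
Qed.

(** Since [G] is a complex subspace, dividing by [c] reduces this to [min_orthogonal]. *)
Lemma min_pythagoras c y : G y -> y.1 0%N = 0 ->
  NP (pcomb c x y) = nrm2 c * NP x + NP y.
Proof.
move=> Gy y0; have [->|c0] := eqVneq c 0.
  rewrite nrm20 mul0r add0r; congr NP; case: y Gy y0 => f g _ _.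
  by congr (_, _); apply/funext => n; rewrite /= /comb mul0r add0r.
have Gy' : G (pcomb c^-1 y p0) by exact: sg_comb hG _ _ _ Gy (sg_0 hG).
have y'0 : (pcomb c^-1 y p0).1 0%N = 0 by rewrite /= /comb/= y0 mulr0 addr0.
have Hy := sg_HP hG Gy.
have -> : pcomb c x y = pcomb c (pcomb 1 (pcomb c^-1 y p0) x) p0.
  by congr (_, _); apply/funext => n; rewrite /= /comb/= !addr0 mul1r mulrDr mulVKf// addrC.
rewrite NP_scale; last exact/HP_comb/Hx/(sg_HP hG Gy').
rewrite min_orthogonal// NP_scale// mulrDr mulrA -nrm2M divff//.
by rewrite (_ : nrm2 1 = 1) ?mul1r// /nrm2/= expr1n expr0n addr0.
Qed.

Lemma pmulS h : pmul h x = pcomb (h 0%N) x (pshift (pmul (backshift h) x)).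
Proof. by rewrite /pmul /pcomb -!cauchyS. Qed.

(** In the Horner step the summands [h(0) x] and [z (...)] are orthogonal, so multiplication of [x]
    by polynomials is isometric up to the factor [NP x]. *)
Lemma pmul_trunc n h : G (pmul (trunc n h) x) /\
  NP (pmul (trunc n h) x) = NP x * series (fun k => nrm2 (h k)) n.
Proof.
elim: n h => [|n IH] h.
  rewrite (_ : pmul _ _ = p0); last by rewrite /pmul !cauchy0.
  by rewrite (HP0 R).2 seriesEord/= big_ord0 mulr0; split=> //; exact: sg_0 hG.
rewrite pmulS backshift_truncS /=; have [Gh Nh] := IH (backshift h).
have Gs := sg_shift hG Gh; split; first exact: sg_comb hG _ _ _ Gx Gs.
rewrite min_pythagoras// (NP_shift (sg_HP hG Gh)).2 Nh /trunc /=.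
rewrite !seriesEord/= big_ord_recl mulrDr mulrC; congr (_ + _ * _).
Qed.

(** The first [N] coefficients of [h x] depend only on the truncation of [h], so the polynomial case
    suffices. *)
Lemma pmul_qseries_le h B N : (forall N, series (fun k => nrm2 (h k)) N <= B) ->
  series (qn (pmul h x)) N <= NP x * B.
Proof.
move=> hB; have [Gh Nh] := pmul_trunc N h.
rewrite (_ : series _ N = series (qn (pmul (trunc N h) x)) N); last first.
  rewrite !seriesEord/=; apply: eq_bigr => i _.
  by rewrite /qn /pmul /= !cauchy_trunc.
apply: le_trans (qseries_le_NP _ (sg_HP hG Gh)) _; rewrite Nh.
by rewrite ler_pM2l ?NP_min_gt0.
Qed.

Lemma N2_tail h (e : R) : H2 h -> 0 < e -> exists n, forall N,
  series (fun k => nrm2 (comb (-1) h (trunc n h) k)) N <= e.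
Proof.
move=> hh e0; move/cvgrPdist_lt: (hh) => /(_ _ e0) [n _ /(_ _ (leqnn n)) /= hn].
exists n => N; have ge0 k : 0 <= nrm2 (comb (-1) h (trunc n h) k) by exact: nrm2_ge0.
apply: (@le_trans _ _ (series (fun k => nrm2 (comb (-1) h (trunc n h) k)) (n + N))).
  by apply: nondecreasing_series => //; rewrite leq_addl.
have -> : series (fun k => nrm2 (comb (-1) h (trunc n h) k)) (n + N) =
    series (fun k => nrm2 (h k)) (n + N) - series (fun k => nrm2 (h k)) n.
  rewrite !seriesEord/= !big_split_ord /= addrAC subrr add0r big1 ?add0r.
    apply: eq_bigr => i _; rewrite /comb /trunc /=.
    have -> : (n + i < n)%N = false by lia.
    by rewrite addr0 mulN1r; case: (h _) => ? ?; rewrite /nrm2 /= !sqrrN.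
  by move=> i _; rewrite /comb /trunc /= ltn_ord mulN1r addNr nrm20.
have := nnseries_le_lim (n + N) (fun k => nrm2_ge0 (h k)) hh.
move: hn => /(le_lt_trans (ler_norm _)); lra.
Qed.

Lemma pmul_dense h (e : R) : H2 h -> 0 < e -> exists n,
  HP (pcomb (-1) (pmul h x) (pmul (trunc n h) x)) /\
  NP (pcomb (-1) (pmul h x) (pmul (trunc n h) x)) < e.
Proof.
move=> hh e0; have d0 : 0 < e / NP x / 2 by rewrite !divr_gt0 ?NP_min_gt0.
have [n hn] := N2_tail hh d0; exists n.
have -> : pcomb (-1) (pmul h x) (pmul (trunc n h) x) = pmul (comb (-1) h (trunc n h)) x.
  by rewrite /pmul /pcomb !cauchy_comb_l.
have b N := pmul_qseries_le N hn.
split; first exact: HP_bounded b.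
apply: le_lt_trans (NP_le b) _.
by rewrite mulrA mulrCA divff ?gt_eqF ?NP_min_gt0// mulr1; lra.
Qed.

(** Truncations of [h] give elements of [G] converging to [h x], and [G] is closed. *)
Lemma G_pmul h : H2 h -> G (pmul h x).
Proof.
move=> hh; apply: (sg_closed hG) => [|e e0].
  apply: (@HP_bounded _ _ (NP x * N2 h)) => N; apply: pmul_qseries_le => M.
  by apply: nnseries_le_lim => // n; exact: nrm2_ge0.
have [n [h1 h2]] := pmul_dense hh e0.
by exists (pmul (trunc n h) x) => //; exact: (pmul_trunc n h).1.
Qed.

(** One step of a Wold decomposition: remove the multiple of [x] carrying the constant term, then
    divide by [z]. *)
Definition strip w : P := pback (pcomb (- w.1 0%N) x w).

Lemma strip_spec w : G w -> [/\ G (strip w),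
  w = pcomb (w.1 0%N) x (pshift (strip w)) &
  NP w = nrm2 (w.1 0%N) * NP x + NP (strip w)].
Proof.
move=> Gw; have Gy := sg_comb hG (- w.1 0%N) Gx Gw.
have y0 : (pcomb (- w.1 0%N) x w).1 0%N = 0 by rewrite /= /comb x0 mulr1 addNr.
have [y20 Gs] := sg_back hG Gy y0.
have ws : w = pcomb (w.1 0%N) x (pshift (strip w)).
  rewrite {1}[w]surjective_pairing /strip /pcomb /pshift /pback /= !zshift_backshift//.
  by congr (_, _); apply/funext => n; rewrite /comb mulNr addNKr.
split=> //; rewrite {1}ws min_pythagoras ?(NP_shift (sg_HP hG Gs)).2//.
exact: sg_shift hG _ Gs.
Qed.

(** The coefficients of [h] are the constant terms met while stripping [w] repeatedly; Pythagoras at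
    each step bounds the sum of their squared moduli by [NP w / NP x]. *)
Lemma G_factor w : G w -> exists2 h, H2 h & w = pmul h x.
Proof.
move=> Gw; pose h : seqC R := fun k => (iter k strip w).1 0%N; exists h.
  apply: (@H2_bounded _ _ (NP w / NP x)) => N; rewrite ler_pdivlMr ?NP_min_gt0//.
  rewrite seriesEord/= {}/h; elim: N w Gw => [|N IH] w Gw.
    by rewrite big_ord0 mul0r; exact/NP_ge0/(sg_HP hG).
  have [Gs _ ->] := strip_spec Gw; rewrite big_ord_recl mulrDl lerD2l.
  apply: le_trans (IH _ Gs); rewrite le_eqVlt; apply/orP; left; apply/eqP.
  by congr (_ * _); apply: eq_bigr => i _; rewrite -iterSr.
(* The induction is on the coefficient for all [w] at once: coefficient [n + 1] of [w] is that of
   [w(0) x] plus coefficient [n] of [strip w]. *)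
have eqn n : w.1 n = cauchy h x.1 n /\ w.2 n = cauchy h x.2 n.
  rewrite {}/h; elim: n w Gw => [|n IH] w Gw; have [Gs ws _] := strip_spec Gw.
    rewrite !cauchy_coef0; split; first by rewrite /= x0 mulr1.
    by rewrite [in LHS]ws /= /comb/= addr0.
  rewrite cauchyS [cauchy _ x.2]cauchyS.
  have [] := IH _ Gs.
  rewrite (_ : (fun k => _) = backshift (fun k => (iter k strip w).1 0%N)); last first.
    by apply/funext => k; rewrite /backshift iterSr.
  by move=> e1 e2; split; rewrite [in LHS]ws; congr (_ + _).
by rewrite [LHS]surjective_pairing; congr (_, _); apply/funext => n; have [] := eqn n.
Qed.

End Wandering.

(** * Absolute convergence, products and bounds in the disc *)

Section PowerSeries.
Variable R : realType.
Local Notation C := (R[i]).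
Implicit Types (a b f g h : seqC R) (n k N : nat) (c z : C) (r : R).

Definition cabs c : R := Num.sqrt (nrm2 c).

Lemma cabsE c : cabs c = Normc.normc c.
Proof. by case: c. Qed.

Lemma cabs_ge0 c : 0 <= cabs c.
Proof. exact: sqrtr_ge0. Qed.

Lemma cabs0 : cabs 0 = 0.
Proof. by rewrite /cabs nrm20 sqrtr0. Qed.

Lemma sqr_cabs c : cabs c ^+ 2 = nrm2 c.
Proof. by rewrite sqr_sqrtr// nrm2_ge0. Qed.

Lemma cabsM c z : cabs (c * z) = cabs c * cabs z.
Proof. by rewrite /cabs nrm2M sqrtrM ?nrm2_ge0. Qed.

Lemma nrm2X c n : nrm2 (c ^+ n) = nrm2 c ^+ n.
Proof.
elim: n => [|n IH]; last by rewrite !exprS nrm2M IH.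
by rewrite !expr0 /nrm2 /= expr1n expr0n addr0.
Qed.

Lemma cabsX c n : cabs (c ^+ n) = cabs c ^+ n.
Proof.
elim: n => [|n IH]; last by rewrite !exprS cabsM IH.
by rewrite !expr0 /cabs /nrm2 /= expr1n expr0n addr0 sqrtr1.
Qed.

Lemma cabsD c z : cabs (c + z) <= cabs c + cabs z.
Proof. by rewrite !cabsE; exact: le_normcD. Qed.

Lemma cabs_sum (I : Type) (s : seq I) (F : I -> C) :
  cabs (\sum_(i <- s) F i) <= \sum_(i <- s) cabs (F i).
Proof.
elim: s => [|i s IH]; first by rewrite !big_nil cabs0.
by rewrite !big_cons; apply: le_trans (cabsD _ _) _; rewrite lerD2l.
Qed.

Lemma Re_le_cabs c : `|complex.Re c| <= cabs c.
Proof.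
rewrite -(@ler_pXn2r _ 2)// ?nnegrE ?cabs_ge0// sqr_cabs real_normK ?num_real//.
by rewrite lerDl sqr_ge0.
Qed.

Lemma Im_le_cabs c : `|complex.Im c| <= cabs c.
Proof.
rewrite -(@ler_pXn2r _ 2)// ?nnegrE ?cabs_ge0// sqr_cabs real_normK ?num_real//.
by rewrite lerDr sqr_ge0.
Qed.

Lemma cvC_squeeze (u : nat -> C) (e : nat -> R) : (forall n, cabs (u n) <= e n) ->
  e @ \oo --> (0 : R) -> cvC u 0.
Proof.
move=> ue /cvgr0Pnorm_lt e0; split; apply/cvgr0Pnorm_lt => d /e0 [K _ eK];
  exists K => // n /eK /= /(le_lt_trans (ler_norm _)); apply: le_lt_trans;
  apply: le_trans (ue n); [exact: Re_le_cabs|exact: Im_le_cabs].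
Qed.

Lemma cabs_lim_le (u : nat -> C) l (B : R) : cvC u l -> (forall n, cabs (u n) <= B) ->
  cabs l <= B.
Proof.
move=> /nrm2_cvg cu uB; have B0 : 0 <= B := le_trans (cabs_ge0 _) (uB 0%N).
rewrite -(@ler_pXn2r _ 2)// ?nnegrE ?cabs_ge0// sqr_cabs.
apply: cvgr_to_le cu _; apply: nearW => n.
by rewrite -sqr_cabs ler_pXn2r ?nnegrE ?cabs_ge0.
Qed.

Lemma Re_sum n (F : nat -> C) : complex.Re (\sum_(i < n) F i) = \sum_(i < n) complex.Re (F i).
Proof.
elim: n => [|n IH]; first by rewrite !big_ord0.
by rewrite !big_ord_recr /= -IH; case: (\sum_(i < n) F i) (F n) => ? ? [].
Qed.

Lemma Im_sum n (F : nat -> C) : complex.Im (\sum_(i < n) F i) = \sum_(i < n) complex.Im (F i).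
Proof.
elim: n => [|n IH]; first by rewrite !big_ord0.
by rewrite !big_ord_recr /= -IH; case: (\sum_(i < n) F i) (F n) => ? ? [].
Qed.

Lemma abs_cvgC (u : nat -> C) (B : R) : (forall N, \sum_(k < N) cabs (u k) <= B) ->
  cvgC (fun N => \sum_(k < N) u k).
Proof.
move=> uB; have cs : cvgn (series (fun k => cabs (u k))).
  apply: (@nnseries_cvg _ _ B) => [n|N]; first exact: cabs_ge0.
  by rewrite seriesEord; exact: uB.
split.
- rewrite (_ : (fun n => _) = series (fun k => complex.Re (u k))).
    apply: normed_cvg; apply: series_le_cvg cs => n /=; rewrite ?normr_ge0 ?cabs_ge0//.
    exact: Re_le_cabs.
  by apply/funext => n; rewrite seriesEord/= Re_sum.
- rewrite (_ : (fun n => _) = series (fun k => complex.Im (u k))).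
    apply: normed_cvg; apply: series_le_cvg cs => n /=; rewrite ?normr_ge0 ?cabs_ge0//.
    exact: Im_le_cabs.
  by apply/funext => n; rewrite seriesEord/= Im_sum.
Qed.

(** Both sides sum over the triangle [i + j < N]. The ring is general because moduli and complex
    terms both need it. *)
Lemma sum_convolution (K : pzRingType) (A F : nat -> K) N :
  \sum_(k < N) \sum_(i < k.+1) A i * F (k - i)%N =
  \sum_(i < N) A i * \sum_(j < (N - i)%N) F j.
Proof.
elim: N => [|N IH]; first by rewrite !big_ord0.
rewrite big_ord_recr IH /= [in LHS]big_ord_recr [in RHS]big_ord_recr /= addrA.
rewrite -big_split /= subnn subSnn big_ord_recl big_ord0 addr0; congr (_ + _).
by apply: eq_bigr => i _; rewrite -mulrDr subSn 1?ltnW// big_ord_recr.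
Qed.

(** Partial sums of the [l^1] norm with weight [r^n]. *)
Definition labs r a N : R := \sum_(k < N) cabs (a k) * r ^+ k.
Definition in_l1 r a : Prop := exists B, forall N, labs r a N <= B.

Lemma labs_ge0 r a N : 0 <= r -> 0 <= labs r a N.
Proof. by move=> r0; apply: sumr_ge0 => i _; rewrite mulr_ge0 ?cabs_ge0 ?exprn_ge0. Qed.

Lemma labs_mono r a M N : 0 <= r -> (M <= N)%N -> labs r a M <= labs r a N.
Proof.
move=> r0 MN; rewrite /labs -(subnKC MN) big_split_ord /= lerDl.
by apply: sumr_ge0 => i _; rewrite mulr_ge0 ?cabs_ge0 ?exprn_ge0.
Qed.

Section RealConvolution.
Variables (r : R) (a f : seqC R).
Hypothesis r0 : 0 <= r.

Let A k : R := cabs (a k) * r ^+ k.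
Let F k : R := cabs (f k) * r ^+ k.
Definition lconv N : R := \sum_(i < N) cabs (a i) * r ^+ i * labs r f (N - i).

Let A0 k : 0 <= A k. Proof. by rewrite mulr_ge0 ?cabs_ge0 ?exprn_ge0. Qed.

Lemma lconvE N : lconv N = \sum_(k < N) \sum_(i < k.+1) A i * F (k - i)%N.
Proof. by rewrite sum_convolution. Qed.

Lemma labs_cauchy_lconv N : labs r (cauchy a f) N <= lconv N.
Proof.
rewrite lconvE; apply: ler_sum => k _; apply: le_trans (ler_wpM2r _ (cabs_sum _ _)) _.
  by rewrite exprn_ge0.
rewrite mulr_suml; apply: ler_sum => i _; rewrite cabsM /A /F.
by rewrite mulrACA -exprD subnKC// -ltnS.
Qed.

Lemma lconv_le N : lconv N <= labs r a N * labs r f N.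
Proof.
rewrite mulr_suml; apply: ler_sum => i _; apply: ler_wpM2l; first exact: A0.
by apply: labs_mono => //; exact: leq_subr.
Qed.

Lemma lconv_ge N : labs r a N * labs r f N <= lconv (N + N).
Proof.
rewrite /lconv big_split_ord /= mulr_suml -[X in X <= _]addr0; apply: lerD.
  apply: ler_sum => i _; apply: ler_wpM2l; first exact: A0.
  by apply: labs_mono => //; have := ltn_ord i; lia.
by apply: sumr_ge0 => i _; apply: mulr_ge0; [exact: A0|exact: labs_ge0].
Qed.

Lemma labs_cauchy N : labs r (cauchy a f) N <= labs r a N * labs r f N.
Proof. exact: le_trans (labs_cauchy_lconv N) (lconv_le N). Qed.

Lemma in_l1_cauchy : in_l1 r a -> in_l1 r f -> in_l1 r (cauchy a f).
Proof.
move=> [B hB] [B' hB']; exists (B * B') => N; apply: le_trans (labs_cauchy N) _.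
by apply: ler_pM; rewrite ?labs_ge0.
Qed.

Lemma labs_cvg (g : seqC R) : in_l1 r g -> cvgn (labs r g).
Proof.
move=> [B hB]; apply: nondecreasing_is_cvgn; last by exists B => _ [n _ <-].
by move=> M N; exact: labs_mono.
Qed.

(** The triangle [i + j < N] lies in the square of side [N], which lies in the triangle of size
    [N + N]; the two monotone sequences therefore share their limit. *)
Lemma lconv_gap : in_l1 r a -> in_l1 r f ->
  (fun N => labs r a N * labs r f N - lconv N) @ \oo --> (0 : R).
Proof.
move=> la lf; have ca := labs_cvg la; have cf := labs_cvg lf.
have caf : (fun N => labs r a N * labs r f N) @ \oo --> limn (labs r a) * limn (labs r f).
  exact: cvgM.
have ndl : nondecreasing_seq lconv.
  move=> M N MN; rewrite !lconvE -(subnKC MN) big_split_ord /= lerDl.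
  apply: sumr_ge0 => k _; apply: sumr_ge0 => i _.
  by rewrite mulr_ge0// /F ?mulr_ge0 ?cabs_ge0 ?exprn_ge0.
have ndaf : nondecreasing_seq (fun N => labs r a N * labs r f N).
  by move=> M N MN; apply: ler_pM; rewrite ?labs_ge0 ?labs_mono.
have lub N : lconv N <= limn (labs r a) * limn (labs r f).
  apply: le_trans (lconv_le N) _; rewrite -(cvg_lim _ caf)//.
  by apply: (nondecreasing_cvgn_le ndaf); apply/cvg_ex; eexists; exact: caf.
have cl : cvgn lconv.
  by apply: nondecreasing_is_cvgn => //; eexists => _ [n _ <-]; exact: lub.
have -> : (0 : R) = limn (labs r a) * limn (labs r f) - limn lconv.
  apply/eqP; rewrite eq_sym subr_eq0 eq_le; apply/andP; split.
    apply: cvgr_to_le caf _; apply: nearW => N; apply: le_trans (lconv_ge N) _.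
    exact: nondecreasing_cvgn_le.
  by apply: limr_le => //; apply: nearW.
exact: cvgB.
Qed.

End RealConvolution.

Lemma psum_abs a z N : \sum_(k < N) cabs (a k * z ^+ k) = labs (cabs z) a N.
Proof. by apply: eq_bigr => k _; rewrite cabsM cabsX. Qed.

Lemma cabs_psum_le a z N : cabs (psum a z N) <= labs (cabs z) a N.
Proof. by rewrite -psum_abs; exact: cabs_sum. Qed.

Lemma in_l1_cvC a z : in_l1 (cabs z) a -> cvC (psum a z) (ps_eval a z).
Proof.
move=> [B hB]; apply: cvgC_cvC; apply: (@abs_cvgC (fun k => a k * z ^+ k) B) => N.
by rewrite psum_abs.
Qed.

Lemma psum_cauchy a f z N : psum (cauchy a f) z N =
  \sum_(i < N) a i * z ^+ i * psum f z (N - i).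
Proof.
rewrite /psum -(sum_convolution (fun i => a i * z ^+ i) (fun i => f i * z ^+ i)).
apply: eq_bigr => k _; rewrite mulr_suml; apply: eq_bigr => i _.
by rewrite mulrACA -exprD subnKC// -ltnS.
Qed.

Lemma psum_tail_le f z M N : (M <= N)%N ->
  cabs (psum f z N - psum f z M) <= labs (cabs z) f N - labs (cabs z) f M.
Proof.
move=> /subnKC <-; set d := (N - M)%N; rewrite /psum /labs !big_split_ord /=.
rewrite addrAC subrr add0r [X in _ <= X]addrAC subrr add0r.
apply: le_trans (cabs_sum _ _) _; apply: ler_sum => j _.
by rewrite cabsM cabsX.
Qed.

(** The error is the sum over the square minus the triangle, dominated by the same sum of moduli. *)
Lemma psum_cauchy_gap a f z N :
  cabs (psum a z N * psum f z N - psum (cauchy a f) z N) <=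
  labs (cabs z) a N * labs (cabs z) f N - lconv (cabs z) a f N.
Proof.
rewrite psum_cauchy {1}/psum mulr_suml /lconv /labs mulr_suml -!sumrB.
apply: le_trans (cabs_sum _ _) _; apply: ler_sum => i _.
rewrite -!mulrBr cabsM cabsM cabsX; apply: ler_wpM2l.
  by rewrite mulr_ge0 ?exprn_ge0 ?cabs_ge0.
exact: psum_tail_le (leq_subr _ _).
Qed.

Lemma ps_eval_cauchy a f z : in_l1 (cabs z) a -> in_l1 (cabs z) f ->
  ps_eval (cauchy a f) z = ps_eval a z * ps_eval f z.
Proof.
move=> la lf; have ca := in_l1_cvC la; have cf := in_l1_cvC lf.
have caf := in_l1_cvC (in_l1_cauchy (cabs_ge0 z) la lf).
have c0 := cvC_squeeze (psum_cauchy_gap a f z) (lconv_gap (cabs_ge0 z) la lf).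
have := cvCD c0 caf; rewrite add0r => h.
apply: (cvC_unique h); rewrite (_ : (fun n => _) = fun n => psum a z n * psum f z n).
  exact: cvCM.
by apply/funext => n; rewrite subrK.
Qed.

Lemma geometric_le (q : R) N : 0 <= q -> q < 1 -> \sum_(k < N) q ^+ k <= (1 - q)^-1.
Proof.
move=> q0 q1; have d0 : 0 < 1 - q by rewrite subr_gt0.
rewrite -[X in _ <= X]mul1r ler_pdivlMr// mulrC.
have := subrX1 q N; have := exprn_ge0 N q0; nra.
Qed.

(* AM-GM in place of Cauchy-Schwarz; [t] is a free weight. *)
Lemma labs_H2_le r f (B t : R) N : 0 <= r -> r < 1 -> 0 < t ->
  series (fun k => nrm2 (f k)) N <= B ->
  labs r f N <= (t * B + (1 - r ^+ 2)^-1 / t) / 2.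
Proof.
move=> r0 r1 t0 fB; apply: (@le_trans _ _
   ((t * series (fun k => nrm2 (f k)) N + (\sum_(k < N) (r ^+ 2) ^+ k) / t) / 2)).
  rewrite seriesEord/= mulr_sumr mulr_suml -big_split /= mulr_suml.
  apply: ler_sum => k _; rewrite -sqr_cabs -exprM mulnC exprM -subr_ge0.
  rewrite (_ : _ - _ = (t * cabs (f k) - r ^+ k) ^+ 2 / t / 2).
    by rewrite !divr_ge0 ?sqr_ge0// ltW.
  by field; rewrite gt_eqF.
have r21 : r ^+ 2 < 1 by rewrite expr_lt1.
have := geometric_le N (sqr_ge0 r) r21 => g.
rewrite ler_pM2r ?invr_gt0// lerD ?ler_pM2l// ler_pM2r ?invr_gt0//.
Qed.

Lemma H2_in_l1 r f : 0 <= r -> r < 1 -> H2 f -> in_l1 r f.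
Proof.
move=> r0 r1 hf; exists ((1 * N2 f + (1 - r ^+ 2)^-1 / 1) / 2) => N.
by apply: labs_H2_le => //; apply: nnseries_le_lim => // n; exact: nrm2_ge0.
Qed.

Lemma disc_cabs z : in_disc z -> cabs z < 1.
Proof. by rewrite /in_disc => z1; rewrite -sqrtr1 ltr_sqrt. Qed.

Lemma in_l1_analytic a : (forall r, 0 <= r -> r < 1 -> in_l1 r a) -> analytic_disc a.
Proof.
move=> ha z /disc_cabs z1; apply: (cvC_cvgC (l := ps_eval a z)).
by apply: in_l1_cvC; exact: ha (cabs_ge0 z) z1.
Qed.

(* Evaluate [k f] at [z], where [k] is the Szego kernel at [z]. *)
Lemma Hinf_of_multiplier f (N0 : R) : H2 f -> 0 <= N0 ->
  (forall h B, (forall N, series (fun k => nrm2 (h k)) N <= B) ->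
     forall N, series (fun k => nrm2 (cauchy h f k)) N <= N0 * B) ->
  Hinf f.
Proof.
move=> hf N00 mf; split; first by apply: in_l1_analytic => r r0 r1; exact: H2_in_l1.
exists (((N0 + 1) / 2) ^+ 2) => z zd; have z1 := disc_cabs zd.
pose h : seqC R := fun n => (z^*)%C ^+ n.
have q0 : 0 <= nrm2 z := nrm2_ge0 z.
have nz : nrm2 (z^*)%C = nrm2 z by case: z {zd z1 h q0} => a b; rewrite /nrm2 /= sqrrN.
(* Both the squared norm of the kernel and its value at [z] are [s], as is the weight term of
   [labs_H2_le] at [t = 1]; cancelling [s] leaves a bound on [f] independent of [z]. *)
set s := (1 - nrm2 z)^-1; have s0 : 0 < s by rewrite invr_gt0 subr_gt0.
have hs N : series (fun k => nrm2 (h k)) N <= s.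
  rewrite seriesEord/= (_ : \sum_(k < N) _ = \sum_(k < N) nrm2 z ^+ k).
    exact: geometric_le.
  by apply: eq_bigr => k _; rewrite /h nrm2X nz.
have lh : in_l1 (cabs z) h.
  by apply: H2_in_l1; rewrite ?cabs_ge0//; exact: H2_bounded hs.
have lf : in_l1 (cabs z) f by apply: H2_in_l1; rewrite ?cabs_ge0.
have ev : ps_eval h z = s%:C%C.
  apply: cvC_limC; rewrite (_ : psum h z = fun N => (series (fun k => nrm2 z ^+ k) N)%:C%C).
    split=> /=; last exact: cvg_cst.
    have := @cvg_geometric_series R 1 (nrm2 z); rewrite ger0_norm// => /(_ zd).
    rewrite mul1r (_ : geometric 1 (nrm2 z) = fun k => nrm2 z ^+ k)//.
    by apply/funext => k; rewrite /geometric /= mul1r.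
  apply/funext => N; rewrite seriesEord/= rmorph_sum /=; apply: eq_bigr => k _.
  rewrite /h -exprMn rmorphXn /=; congr (_ ^+ _).
  by case: z {zd z1 h q0 nz s s0 hs lh lf} => a b; apply/eqP; rewrite eq_complex /nrm2 /=;
    apply/andP; split; apply/eqP; ring.
have bound N : cabs (psum (cauchy h f) z N) <= (N0 + 1) / 2 * s.
  apply: le_trans (cabs_psum_le _ _ _) _.
  apply: le_trans (labs_H2_le (cabs_ge0 z) z1 ltr01 (mf _ _ hs N)) _.
  by rewrite sqr_cabs -/s; lra.
have := cabs_lim_le (in_l1_cvC (in_l1_cauchy (cabs_ge0 z) lh lf)) bound.
rewrite ps_eval_cauchy// ev cabsM.
have -> : cabs s%:C%C = s by rewrite /cabs /nrm2 /= expr0n addr0 sqrtr_sqr gtr0_norm.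
rewrite mulrC ler_pM2r// => le.
by rewrite -sqr_cabs ler_pXn2r ?nnegrE ?cabs_ge0// divr_ge0// addr_ge0.
Qed.

Lemma H2_zshift f : H2 f -> H2 (zshift f).
Proof.
by move=> hf; have [] // := HP_H2 (NP_shift (HP_N2 (x := (f, f)) hf hf).1).1.
Qed.

Lemma H2_cauchy_trunc n h f : H2 f -> H2 (cauchy (trunc n h) f).
Proof.
move=> hf; elim: n h => [|n IH] h; first by rewrite cauchy0; exact: H2_zero.
by rewrite cauchyS backshift_truncS; apply: H2_comb => //; exact: H2_zshift.
Qed.

Lemma H2_polyseqC_mul (p : seq C) f : H2 f -> H2 (cauchy (polyseqC p) f).
Proof. by rewrite polyseqC_trunc; exact: H2_cauchy_trunc. Qed.

Lemma H2_seq1 : H2 (seq1 : seqC R).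
Proof.
apply: (@H2_bounded _ _ 1) => N; rewrite seriesEord/=.
case: N => [|N]; first by rewrite big_ord0.
rewrite big_ord_recl big1 => [|i _]; last by rewrite /seq1 nrm20.
by rewrite /seq1 /nrm2 /= expr1n expr0n /= !addr0.
Qed.

(* If [p a = 1 - v] then [1/a = p + v (1/a)], so a small [v] bounds [1/a] in [l^1_r]. *)
Lemma outer_recip_in_l1 a r : outer a -> a 0%N = 1 -> 0 <= r -> r < 1 ->
  in_l1 r (recip a).
Proof.
move=> [ha da] a0 r0 r1; have r21 : 0 < 1 - r ^+ 2 by rewrite subr_gt0 expr_lt1.
(* With [|v|^2 < (1 - r^2) / 4] and the weight [t = 2 / (1 - r^2)] chosen below, each of the two
   terms of [labs_H2_le] is at most [1/2], so [v] has [l^1_r] norm at most [1/2]. *)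
have e0 : 0 < Num.sqrt ((1 - r ^+ 2) / 4) by rewrite sqrtr_gt0 divr_gt0.
have [p] := da _ H2_seq1 _ e0; set P := polyseqC p => pd.
have hP : H2 P.
  by rewrite -[P]cauchy1 cauchyC; exact: H2_polyseqC_mul H2_seq1.
pose v := comb (-1) (cauchy P a) seq1.
have vE : (fun n => nrm2 (cauchy P a n - seq1 n)) = fun n => nrm2 (v n).
  apply/funext => n; rewrite /v /comb; case: (cauchy P a n) (seq1 n) => ? ? [? ?].
  by rewrite /nrm2 /=; ring.
have [Bp hBp] := H2_in_l1 r0 r1 hP.
have hv : H2 v by apply: H2_comb H2_seq1; exact: H2_polyseqC_mul.
have Nv : N2 v < (1 - r ^+ 2) / 4.
  move: pd; rewrite /H2dist /H2norm vE ltr_sqrt//.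
  by rewrite divr_gt0.
have lv N : labs r v N <= 2^-1.
  have t0 : 0 < 2 / (1 - r ^+ 2) by rewrite divr_gt0.
  have fv := nnseries_le_lim N (fun k => nrm2_ge0 (v k)) hv.
  apply: le_trans (labs_H2_le r0 r1 t0 fv) _.
  apply: (@le_trans _ _ ((2 / (1 - r ^+ 2) * ((1 - r ^+ 2) / 4) +
     (1 - r ^+ 2)^-1 / (2 / (1 - r ^+ 2))) / 2)).
    by rewrite ler_pM2r ?invr_gt0// lerD2r ler_pM2l// ltW.
  rewrite le_eqVlt; apply/orP; left; apply/eqP; field.
  by rewrite gt_eqF.
have rE : recip a = comb 1 P (cauchy v (recip a)).
  rewrite /v cauchy_comb_l cauchy1 -cauchyA cauchy_recip// cauchyC cauchy1.
  by apply/funext => n; rewrite /comb; ring.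
exists (2 * Bp) => N.
(* These are finite sums, so the last term can be absorbed on the left before convergence of [1/a]
   is known. *)
have : labs r (recip a) N <= labs r P N + 2^-1 * labs r (recip a) N.
  apply: (@le_trans _ _ (labs r P N + labs r (cauchy v (recip a)) N)).
    rewrite {1}rE /labs -big_split /=; apply: ler_sum => k _; rewrite -mulrDl.
    by apply: ler_wpM2r; rewrite ?exprn_ge0// /comb mul1r; exact: cabsD.
  rewrite lerD2l; apply: le_trans (labs_cauchy _ _ r0 N) _.
  by apply: ler_wpM2r; rewrite ?labs_ge0.
by have := hBp N; lra.
Qed.

End PowerSeries.

(** * Distances in [H^2] expressed by squared norms *)

Section Graphs.
Variable R : realType.
Local Notation C := (R[i]).
Local Notation P := (seqC R * seqC R)%type.
Implicit Types (f g h : seqC R) (x y w : P) (n k : nat) (c : C).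

Lemma H2dist_comb f g : H2dist f g = Num.sqrt (N2 (comb (-1) g f)).
Proof.
rewrite /H2dist /H2norm; congr (Num.sqrt (limn (series _))).
by apply/funext => n; rewrite /comb mulN1r addrC.
Qed.

Lemma H2dist_lt f g (e : R) : H2 f -> H2 g -> 0 < e ->
  (H2dist f g < e) = (N2 (comb (-1) g f) < e ^+ 2).
Proof.
move=> hf hg e0; rewrite H2dist_comb -[in LHS](gtr0_norm e0) -sqrtr_sqr ltr_sqrt//.
by rewrite exprn_gt0.
Qed.

Lemma N2_comb_le c f g : H2 f -> H2 g -> N2 (comb c f g) <= 2 * nrm2 c * N2 f + 2 * N2 g.
Proof.
move=> hf hg; apply: nnseries_lim_le => [n|N]; first exact: nrm2_ge0.
apply: (@le_trans _ _ (2 * nrm2 c * series (fun n => nrm2 (f n)) N +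
  2 * series (fun n => nrm2 (g n)) N)).
  rewrite !seriesEord/= !mulr_sumr -big_split; apply: ler_sum => i _ /=.
  exact: nrm2_comb_le.
by apply: lerD; apply: ler_wpM2l; rewrite ?mulr_ge0 ?nrm2_ge0//;
  apply: nnseries_le_lim => // n; exact: nrm2_ge0.
Qed.

Lemma H2_backshift f : H2 f -> H2 (backshift f).
Proof.
move=> hf; apply: (@H2_bounded _ _ (N2 f)) => N.
apply: le_trans (nnseries_le_lim N.+1 (fun k => nrm2_ge0 (f k)) hf).
by rewrite !seriesEord/= big_ord_recl lerDr nrm2_ge0.
Qed.

Lemma combB f g : comb (-1) f g = fun n => g n - f n.
Proof. by apply/funext => n; rewrite /comb mulN1r addrC. Qed.

(** * The graph of a multiplication operator *)

Section MultiplicationGraph.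
Variable phi : seqC R.

Definition mult_graph y : Prop := HP y /\ y.2 = cauchy phi y.1.

(** Each coefficient of [phi f] involves finitely many coefficients of [f], hence is continuous in
    [f], and the relation passes to limits. *)
Lemma mult_graph_closed x : HP x -> pdense_at mult_graph x -> mult_graph x.
Proof.
move=> Hx dx; split=> //; apply/funext => n; apply/eqP; rewrite -subr_eq0; apply/eqP.
set r := x.2 n - _; pose K := 1 + \sum_(i < n.+1) cabs (phi i).
have K0 : 0 < K by rewrite ltr_wpDr// sumr_ge0// => i _; exact: cabs_ge0.
suff rK d : 0 < d -> cabs r <= K * d.
  apply: nrm2_eq0; rewrite -sqr_cabs; apply/eqP; rewrite sqrf_eq0.
  case: (ltgtP 0 (cabs r)) (cabs_ge0 r) => // r0 _.
  have := rK (cabs r / K / 2); rewrite !divr_gt0// => /(_ isT).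
  have -> : K * (cabs r / K / 2) = cabs r / 2 by field; rewrite gt_eqF.
  lra.
move=> d0; have [y [Hy y2] [Hd Nd]] := dx _ (exprn_gt0 2 d0).
set v := pcomb (-1) x y in Hd Nd.
have vd m : cabs (v.1 m) <= d /\ cabs (v.2 m) <= d.
  have := le_trans (qn_le_NP m Hd) (ltW Nd).
  rewrite /qn -!sqr_cabs => h; split; rewrite -(@ler_pXn2r _ 2)// ?nnegrE ?cabs_ge0 ?(ltW d0)//;
    apply: le_trans h; by rewrite ?lerDl ?lerDr sqr_ge0.
have -> : r = cauchy phi v.1 n - v.2 n.
  by rewrite /r /v /= y2 cauchy_comb_r !combB; ring.
apply: le_trans (cabsD _ _) _; rewrite /K mulrDl mul1r addrC; apply: lerD.
  by rewrite (_ : cabs (- _) = cabs (v.2 n)) ?(vd n).2// /cabs /nrm2; case: (v.2 n) => ? ? /=; rewrite !sqrrN.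
rewrite mulr_suml; apply: le_trans (cabs_sum _ _) _; apply: ler_sum => i _.
by rewrite cabsM; apply: ler_wpM2l; [exact: cabs_ge0|exact: (vd _).1].
Qed.

Lemma mult_graph_shift_graph :
  (exists2 x, mult_graph x & x.1 0%N != 0) -> shift_graph mult_graph.
Proof.
move=> nt; split=> //.
- by move=> x [].
- by split; [exact: (HP0 R).1|rewrite cauchyC cauchy0].
- move=> c x y [Hx x2] [Hy y2]; split; first exact: HP_comb.
  by rewrite /= x2 y2 cauchy_comb_r.
- exact: mult_graph_closed.
- move=> x [Hx x2]; split; first exact: (NP_shift Hx).1.
  by rewrite /= x2 cauchy_zshift.
- move=> x [Hx x2] x10; have x2E : x.2 = zshift (cauchy phi (backshift x.1)).
    by rewrite -cauchy_zshift zshift_backshift.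
  have [h1 h2] := HP_H2 Hx.
  split; first by rewrite x2E.
  split; last by rewrite /= x2E.
  by apply: (HP_N2 (x := pback x) _ _).1; exact: H2_backshift.
Qed.

End MultiplicationGraph.

(** * Nested graphs with an outer first entry have the same minimal element *)

Section Comparison.
Variables (G G' : P -> Prop) (x x' : P).
Hypotheses (hG : shift_graph G) (hG' : shift_graph G') (GG' : forall y, G y -> G' y).
Hypotheses (Gx : G x) (x0 : x.1 0%N = 1)
  (xmin : forall y, G y -> y.1 0%N = 1 -> NP x <= NP y).
Hypotheses (Gx' : G' x') (x'0 : x'.1 0%N = 1)
  (xmin' : forall y, G' y -> y.1 0%N = 1 -> NP x' <= NP y).
Hypothesis ox : outer x.1.

(* With [x = theta x'] and [p a] close to [1], the multiplier [k = p a'] satisfies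
   [k x = (p a) x'], so [|p 0|^2 NP x <= NP (k x) = NP ((p a) x') <= NP x' |p a|^2]. *)
Lemma NP_min_approx (e : R) : 0 < e -> e <= 4^-1 ->
  exists2 q : R, 4^-1 <= q & q * NP x <= NP x' * (q + e).
Proof.
move=> e0 e4; have [ha da] := ox.
have se0 : 0 < Num.sqrt e by rewrite sqrtr_gt0.
have [p] := da _ (@H2_seq1 R) _ se0; set p_ := polyseqC p.
have hu : H2 (cauchy p_ x.1) by exact: H2_polyseqC_mul.
set u := cauchy p_ x.1 in hu *; set v := comb (-1) seq1 u.
rewrite H2dist_lt//; last exact: H2_seq1.
rewrite sqr_sqrtr ?ltW// -/v => Nv.
have hv : H2 v by apply: H2_comb => //; exact: H2_seq1.
have [th hth xth] := G_factor hG' Gx' x'0 xmin' (GG' Gx).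
have [hx'1 _] := HP_H2 (sg_HP hG' Gx').
pose k := cauchy p_ x'.1; have hk : H2 k by exact: H2_polyseqC_mul.
have kx : pmul k x = pmul u x'.
  have -> : u = cauchy k th.
    by rewrite /u /k xth /= -cauchyA (cauchyC x'.1).
  by rewrite {1}xth /pmul /= !cauchyA.
have u0 : u 0%N = p_ 0%N by rewrite /u cauchy_coef0 x0 mulr1.
have k0 : k 0%N = p_ 0%N by rewrite /k cauchy_coef0 x'0 mulr1.
have v0 : v 0%N = p_ 0%N - 1 by rewrite /v combB u0.
(* The constant term of [v = p a - 1] gives [|p(0) - 1|^2 <= e <= 1/4], hence [|p(0)| >= 1/2]. *)
exists (nrm2 (p_ 0%N)).
  have := le_trans (nrm2_le_N2 0 hv) (ltW Nv); rewrite v0.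
  by case: (p_ 0%N) => a b; rewrite /nrm2 /=; nra.
apply: (@le_trans _ _ (NP (pmul k x))).
  have Gs := sg_shift hG (G_pmul hG Gx x0 xmin (H2_backshift hk)).
  rewrite pmulS (min_pythagoras hG Gx x0 xmin)// k0 lerDl.
  exact: NP_ge0 (sg_HP hG Gs).
rewrite kx; apply: NP_le => N; apply: (pmul_qseries_le hG' Gx' x'0 xmin') => {}N.
case: N => [|N]; first by rewrite seriesEord/= big_ord0 addr_ge0 ?nrm2_ge0 ?ltW.
(* Past the constant term [p a] and [v] agree, so [|p a|^2 <= |p(0)|^2 + |v|^2]. *)
have : series (fun k => nrm2 (v k)) N.+1 <= N2 v.
  by apply: nnseries_le_lim => // i; exact: nrm2_ge0.
rewrite !seriesEord/= !big_ord_recl /= u0 lerD2l => h.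
apply: le_trans (ltW Nv); apply: le_trans h.
rewrite (_ : \sum_(i < N) nrm2 (u _) = \sum_(i < N) nrm2 (v (bump 0 i))) ?lerDr ?nrm2_ge0//.
by apply: eq_bigr => i _; rewrite /v combB /seq1 subr0.
Qed.

(** As [x - x'] is orthogonal to [x'], [NP x = NP x' + NP (x - x')]; the inequality [NP x <= NP x']
    then forces equality. *)
Lemma min_unique : x = x'.
Proof.
have le : NP x <= NP x'.
  rewrite leNgt; apply/negP => lt.
  have N0 := NP_min_gt0 hG' Gx' x'0.
  set d := NP x - NP x'; have d0 : 0 < d by rewrite subr_gt0.
  (* This choice would give [q d <= e NP x' <= d / 8], against [q >= 1/4]. *)
  pose e := Num.min 4^-1 (d / (8 * NP x')).
  have dN0 : 0 < d / (8 * NP x') by rewrite divr_gt0// mulr_gt0.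
  have e0 : 0 < e by rewrite lt_min dN0 andbT invr_gt0.
  have [|q q4 hq] := NP_min_approx e0; first by rewrite ge_min lexx.
  have : e * NP x' <= d / 8.
    apply: (@le_trans _ _ (d / (8 * NP x') * NP x')).
      by apply: ler_wpM2r; [exact: ltW|rewrite ge_min lexx orbT].
    by rewrite le_eqVlt; apply/orP; left; apply/eqP; field; rewrite gt_eqF.
  have : 4^-1 * d <= q * d by rewrite ler_pM2r.
  move: hq; rewrite /d; nra.
pose y := pcomb (-1) x' x.
have Gy : G' y by exact: sg_comb hG' _ _ _ Gx' (GG' Gx).
have y0 : y.1 0%N = 0 by rewrite /= combB x0 x'0 subrr.
have xE : x = pcomb 1 y x'.
  rewrite {1}[x]surjective_pairing /y /pcomb /=.
  by congr (_, _); apply/funext => n; rewrite combB /comb mul1r subrK.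
have Hy := sg_HP hG' Gy.
have yp0 : y = p0.
  apply: NP_eq0 => //; move: le; rewrite {1}xE (min_orthogonal hG' Gx' x'0 xmin')//.
  by rewrite gerDl.
rewrite xE yp0 [RHS]surjective_pairing /pcomb /=.
by congr (_, _); apply/funext => n; rewrite /comb mulr0 add0r.
Qed.

End Comparison.

(** * The graph of the operator [T] *)

Section OperatorGraph.
Variables (D : set (seqC R)) (T : seqC R -> seqC R).
Hypothesis ST : sarason_toeplitz D T.
Hypothesis T0 : forall f, D f -> T (zshift f) 0%N = 0.

(** Condition (2) determines [T (z f)] up to its constant term, which [T0] makes zero. *)
Lemma T_zshift f : D f -> T (zshift f) = zshift (T f).
Proof.
have [_ _ bT _] := ST => Df; rewrite -(bT _ Df) zshift_backshift//; exact: T0.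
Qed.

Definition op_graph y : Prop := D y.1 /\ y.2 = T y.1.

Lemma op_graph_H2 y : op_graph y -> H2 y.1 /\ H2 y.2.
Proof. by have [[DH _ _ _] _ _ _] := ST => -[/DH + ->]. Qed.

Lemma op_graph_closed x : HP x -> pdense_at op_graph x -> op_graph x.
Proof.
have [[DH _ _ clT] _ _ _] := ST => Hx dx; have [hx1 hx2] := HP_H2 Hx.
(* Closedness of [T] is stated for sequences and unsquared distances, hence the squared rate. *)
have /choice[Y hY] k : exists y, op_graph y /\
    NP (pcomb (-1) x y) < @harmonic R k ^+ 2.
  by have [y Gy [_ Ny]] := dx _ (exprn_gt0 2 (harmonic_gt0 k)); exists y.
have dist k : H2dist (Y k).1 x.1 < @harmonic R k /\ H2dist (Y k).2 x.2 < @harmonic R k.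
  have [Gy Ny] := hY k; have [hy1 hy2] := op_graph_H2 Gy.
  have hc1 : H2 (comb (-1) x.1 (Y k).1) by exact: H2_comb.
  have hc2 : H2 (comb (-1) x.2 (Y k).2) by exact: H2_comb.
  rewrite !H2dist_lt ?harmonic_gt0//.
  have := (HP_N2 (x := pcomb (-1) x (Y k)) hc1 hc2).2 => /= NE; rewrite NE in Ny.
  by split; apply: le_lt_trans Ny; rewrite ?lerDl ?lerDr N2_ge0.
have cv (u : nat -> R) : (forall k, 0 <= u k) -> (forall k, u k < @harmonic R k) ->
    u @ \oo --> (0 : R).
  move=> u0 uh; apply: (@squeeze_cvgr _ _ _ _ (fun=> 0) (@harmonic R)).
  - by apply: nearW => k; rewrite u0 ltW.
  - exact: cvg_cst.
  - exact: cvg_harmonic.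
have [] := clT (fun k => (Y k).1) x.1 x.2 => //.
- by move=> k; have [[]] := hY k.
- apply: cv => k; first exact: sqrtr_ge0.
  by have [] := dist k.
- apply: cv => k; first exact: sqrtr_ge0.
  by have [[_ <-] _] := hY k; have [] := dist k.
Qed.

Lemma op_graph_shift_graph : shift_graph op_graph.
Proof.
have [[DH [D0 [Dadd Dscale]] Ddense _] Dz _ Db] := ST.
have Dcomb c f g : D f -> D g -> D (comb c f g) /\ T (comb c f g) = comb c (T f) (T g).
  move=> Df Dg; have [Dcf Tcf] := Dscale c _ Df; have [Ds Ts] := Dadd _ _ Dcf Dg.
  by split=> //; rewrite Ts Tcf.
split.
- by move=> x /op_graph_H2[h1 h2]; exact: (HP_N2 h1 h2).1.
- split=> //=; have [_] := Dscale 0 _ D0.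
  rewrite (_ : (fun n => 0 * 0) = fun=> 0 : C); last by apply/funext => n; rewrite mul0r.
  by move=> ->; apply/funext => n; rewrite mul0r.
- move=> c x y [Dx x2] [Dy y2]; have [Dc Tc] := Dcomb c _ _ Dx Dy.
  by split=> //=; rewrite Tc x2 y2.
- exact: op_graph_closed.
- by move=> x [Dx x2]; split; [exact: Dz|rewrite /= x2 T_zshift].
- move=> x [Dx x2] x10; have Dbx := Db _ Dx x10.
  have x2E : x.2 = zshift (T (backshift x.1)) by rewrite -T_zshift// zshift_backshift.
  by split; [rewrite x2E|split=> //=; rewrite x2E].
(* An element of the domain at distance less than [1] from the constant [1] cannot vanish at [0]. *)
- have [g Dg] := Ddense _ (@H2_seq1 R) _ ltr01; have [hg _] := DH _ Dg.
  rewrite H2dist_lt//; last exact: H2_seq1.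
  rewrite expr1n => Ng; exists (g, T g) => //=; apply/eqP => g0.
  have hc : H2 (comb (-1) g seq1) by apply: H2_comb => //; exact: H2_seq1.
  have := le_lt_trans (nrm2_le_N2 0 hc) Ng.
  by rewrite combB g0 /seq1 subr0 /nrm2 /= expr1n expr0n addr0 ltxx.
Qed.

(** Every [g] in the dense domain is [h a], with [a] the first entry of [x], and truncating [h]
    approximates [g] by polynomial multiples of [a]. *)
Lemma min_outer x : op_graph x -> x.1 0%N = 1 ->
  (forall y, op_graph y -> y.1 0%N = 1 -> NP x <= NP y) -> outer x.1.
Proof.
move=> Gx x0 xmin; have hG := op_graph_shift_graph.
have [[DH _ Ddense _] _ _ _] := ST; have [ha hb] := op_graph_H2 Gx.
split=> // f hf e e0; have e2 : 0 < e / 2 by rewrite divr_gt0.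
have [g Dg] := Ddense _ hf _ e2; have [hg _] := DH _ Dg.
rewrite H2dist_lt// => Nfg.
have [h hh gh] := G_factor hG Gx x0 xmin (conj Dg erefl : op_graph (g, T g)).
have [n [Hd Nd]] := pmul_dense hG Gx x0 xmin hh (exprn_gt0 2 e2).
exists (mkseq h n); rewrite polyseqC_mkseq.
have hu : H2 (cauchy (trunc n h) x.1) by exact: H2_cauchy_trunc.
rewrite H2dist_lt//.
have [hd1 hd2] := HP_H2 Hd.
move: Nd; rewrite (HP_N2 hd1 hd2).2 -gh /= => Nd.
rewrite -gh /= in hd1 hd2; set u := cauchy _ _ in hu Nd hd1 *.
(* Here [u - f = (u - g) - (f - g)], where both terms have squared norm below [(e / 2)^2]; the
   factors [2] of [N2_comb_le] bring the total to [e^2]. *)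
have -> : comb (-1) f u = comb (-1) (comb (-1) g f) (comb (-1) g u).
  by apply/funext => m; rewrite /comb; ring.
have hfg : H2 (comb (-1) g f) by exact: H2_comb.
apply: le_lt_trans (N2_comb_le (-1) hfg hd1) _.
have := N2_ge0 hd2; have -> : nrm2 (-1 : C) = 1 by rewrite /nrm2 /= oppr0 sqrrN expr1n expr0n addr0.
by move: Nfg Nd; rewrite !expr2; lra.
Qed.

End OperatorGraph.
End Graphs.

(** * Construction of the symbol, equality of domains, and sub-symbols *)

Section Symbol.
Variable R : realType.
Local Notation C := (R[i]).
Variables (D : set (seqC R)) (T : seqC R -> seqC R).
Hypothesis ST : sarason_toeplitz D T.
Hypothesis T0 : forall f, D f -> T (zshift f) 0%N = 0.

Lemma exists_symbol : exists phi : seqC R,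
  smirnov phi /\ D = dom_M phi /\ (forall f, D f -> T f = M_op phi f).
Proof.
have hG := op_graph_shift_graph ST T0.
have [x [Gx x0 xmin]] := exists_minimal hG.
have ox := min_outer ST T0 Gx x0 xmin.
have [ha hb] := op_graph_H2 ST Gx.
have N00 := ltW (NP_min_gt0 hG Gx x0).
have mul := pmul_qseries_le hG Gx x0 xmin.
(* Each entry of [h x] has norm at most that of the pair, so both entries of [x] multiply [H^2]
   boundedly. *)
have Ha : Hinf x.1.
  apply: Hinf_of_multiplier ha N00 _ => h B hB N; apply: le_trans (mul _ _ N hB).
  by apply: le_series => n _; rewrite lerDl nrm2_ge0.
have Hb : Hinf x.2.
  apply: Hinf_of_multiplier hb N00 _ => h B hB N; apply: le_trans (mul _ _ N hB).
  by apply: le_series => n _; rewrite lerDr nrm2_ge0.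
have la r : 0 <= r -> r < 1 -> in_l1 r x.1 by move=> r0 r1; exact: H2_in_l1.
have lb r : 0 <= r -> r < 1 -> in_l1 r x.2 by move=> r0 r1; exact: H2_in_l1.
have lr r := @outer_recip_in_l1 R _ r ox x0.
pose phi := cauchy x.2 (recip x.1).
have lphi r : 0 <= r -> r < 1 -> in_l1 r phi.
  by move=> r0 r1; apply: in_l1_cauchy => //; [exact: lb|exact: lr].
have phia : cauchy phi x.1 = x.2.
  by rewrite /phi -cauchyA (cauchyC (recip _)) cauchy_recip// cauchyC cauchy1.
have Tphi f : D f -> T f = M_op phi f.
  move=> Df; have [h _] := G_factor hG Gx x0 xmin (conj Df erefl : op_graph D T (f, T f)).
  move=> [-> ->]; rewrite /M_op -phia (cauchyC h) -cauchyA (cauchyC x.1 h).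
  by rewrite (cauchyC h).
exists phi; split; [|split=> //].
  split; first exact: in_l1_analytic.
  exists x.1, x.2; split=> // z zd; have z1 := disc_cabs zd; have z0 := cabs_ge0 z.
  (* The series of [1/a] converges at [z], and its value times [a(z)] is [1]. *)
  have a0 : ps_eval x.1 z != 0.
    apply/eqP => az; have := ps_eval_cauchy (la _ z0 z1) (lr _ z0 z1).
    rewrite cauchy_recip// az mul0r => /eqP; apply/negP.
    rewrite (_ : ps_eval seq1 z = 1) ?oner_eq0//; apply: cvC_limC.
    have one N : psum seq1 z N.+1 = 1.
      rewrite /psum big_ord_recl big1 => [|i _]; last by rewrite mul0r.
      by rewrite mul1r addr0.
    by split; rewrite -cvg_shiftS /=; under eq_fun do rewrite one; exact: cvg_cst.
  split=> //; apply: (mulIf a0); rewrite divfK// -ps_eval_cauchy ?phia//.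
    exact: lphi.
  exact: la.
apply/seteqP; split=> f.
  move=> Df; have [hf hTf] := op_graph_H2 ST (conj Df erefl : op_graph D T (f, T f)).
  by split=> //; move: hTf; rewrite /= Tphi.
move=> [hf hpf].
have GG' y : op_graph D T y -> mult_graph phi y.
  move=> Gy; have [h1 h2] := op_graph_H2 ST Gy; split; first exact: (HP_N2 h1 h2).1.
  by case: Gy => Dy ->; exact: Tphi.
have hG' : shift_graph (mult_graph phi).
  apply: mult_graph_shift_graph; exists x; first exact: GG'.
  by rewrite x0 oner_eq0.
have [x' [Gx' x'0 xmin']] := exists_minimal hG'.
have xx' := min_unique hG hG' GG' Gx x0 xmin Gx' x'0 xmin' ox.
have Gf : mult_graph phi (f, cauchy phi f).
  by split=> //; exact: (HP_N2 (x := (f, cauchy phi f)) hf hpf).1.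
(* The factorization in the larger graph uses [x' = x], so it is also a factorization through the
   generator of the graph of [T]. *)
have [h hh fh] := G_factor hG' Gx' x'0 xmin' Gf.
by have [] := G_pmul hG Gx x0 xmin hh; rewrite xx' -fh.
Qed.

Lemma iter_zshift_dom n f : D f -> D (iter n (@zshift R) f).
Proof. by have [_ Dz _ _] := ST => Df; elim: n => //= n; exact: Dz. Qed.

(** Under [T0] the negative coefficients of [h_f] vanish, so [h_f] is [T f] and the product is a
    Cauchy product. *)
Lemma fprod_hf f g k : D f ->
  fprod (hf T f) g k = if k is Posz n then cauchy g (T f) n else 0.
Proof.
move=> Df; have neg n : hf T f (Negz n) = 0 by exact/T0/iter_zshift_dom.
apply: cvC_limC; case: k => n; last first.
  rewrite (_ : series _ = fun=> 0); first exact: cvC_cst.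
  apply/funext => N; rewrite seriesEord/= big1// => j _.
  by rewrite NegzE -opprD -PoszD addSn -NegzE neg mul0r.
(* From index [n + 1] on the partial sums are stationary: the terms with [j > n] meet negative
   coefficients of [h_f]. *)
have eqs N : series (fun j => hf T f (Posz n - j%:Z) * g j) (N + n.+1)%N =
    cauchy g (T f) n.
  rewrite seriesEord/= addnC big_split_ord /= [X in _ + X]big1 ?addr0.
    apply: eq_bigr => j _; rewrite mulrC subzn //; exact: ltn_ord j.
  move=> j _; have -> : n%:Z - (n.+1 + j)%N%:Z = Negz j.
    by rewrite NegzE; lia.
  by rewrite neg mul0r.
by split; rewrite -(cvg_shiftn n.+1) /=; under eq_fun do rewrite eqs; exact: cvg_cst.
Qed.

End Symbol.

Theorem theorem1 (R : realType) (D : set (seqC R)) (T : seqC R -> seqC R) :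
  sarason_toeplitz D T ->
  ((exists phi : seqC R,
       smirnov phi /\ D = dom_M phi /\ (forall f, D f -> T f = M_op phi f))
    <-> (forall f, D f -> T (zshift f) 0%N = 0))
  /\
  ((forall f, D f -> T (zshift f) 0%N = 0) ->
   forall f1 f2 : seqC R, D f1 -> f1 <> (fun _ => 0) -> D f2 -> f2 <> (fun _ => 0) ->
     subsymbol_eq T f1 f2).
Proof.
move=> ST; split; first split.
- move=> [phi [_ [_ Tphi]]] f Df; have [_ Dz _ _] := ST.
  by rewrite Tphi ?/M_op ?cauchy_zshift//; exact: Dz.
- exact: exists_symbol ST.
- move=> T0 f1 f2 D1 _ D2 _ k; have [phi [_ [_ Tphi]]] := exists_symbol ST T0.
  rewrite !(fprod_hf ST T0)//; case: k => // n.
  (* Both cross products are [phi f1 f2]. *)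
  rewrite !Tphi// /M_op (cauchyC f2) (cauchyC f1) -!cauchyA.
  by rewrite (cauchyC f1).
Qed.
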